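(* Let $A$ be a unitary $*$-algebra of the type $F+J(A)$ over a field $F$ of characteristic zero, generating a variety with quadratic codimension growth. For the multiplicities $m_{((1)_{0^+},(1)_{t^\epsilon})}$ in the proper cocharacters of $A$, we have: (1) $m_{((1)_{0^+},(1)_{1^+})}=1$ if and only if $U_{3,*}^{gri} \in \mathrm{var}^*(A)$. (2) $m_{((1)_{0^+},(1)_{0^-})}=1$ if and only if $N_{3,*} \in \mathrm{var}^*(A)$. (3) $m_{((1)_{0^+},(1)_{1^-})}=1$ if and only if $N_{3,*}^{gri} \in \mathrm{var}^*(A)$.
   Context: Throughout, $F$ is a field of characteristic zero and algebras are associative over $F$. A superalgebra is an algebra $A=A_0\oplus A_1$ with $A_iA_j\subseteq A_{i+j}$ (indices mod 2). The trivial grading is $(A_0,A_1)=(A,0)$. A superinvolution on $A$ is a linear map $*:A\to A$ with $A_i^*\subseteq A_i$, $(a^* )^*=a$ and $(ab)^*=(-1)^{|a||b|}b^*a^*$ for all homogeneous $a,b$. A $*$-algebra is a superalgebra with a superinvolution; it is unitary if it has a unit. Put $A_i^{+}=\{a\in A_i: a^*=a\}$, $A_i^-=\{a\in A_i:a^*=-a\}$. $J(A)$ is the Jacobson radical; ''of the type $F+J(A)$'' means $A=F1_A+J(A)$. Let $\mathcal F$ be the free associative algebra on the disjoint sets $X_i^\varepsilon=\{x_{1,i}^\varepsilon,x_{2,i}^\varepsilon,\dots\}$, $i\in\{0,1\}$, $\varepsilon\in\{+,-\}$, where variables in $X_i^\varepsilon$ have degree $i$ and are symmetric ($\varepsilon=+$)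 or skew ($\varepsilon=-$). $\mathrm{Id}^*(A)$ is the set of $f\in\mathcal F$ (the $*$-identities) vanishing under all substitutions sending each $x_{j,i}^\varepsilon$ into $A_i^\varepsilon$, and $\mathrm{var}^*(A)$ is the class of all $*$-algebras $B$ with $\mathrm{Id}^*(A)\subseteq\mathrm{Id}^*(B)$. $P_n^*$ is the span of all $w_{\sigma(1)}\cdots w_{\sigma(n)}$, $\sigma\in S_n$, $w_j\in\{x_{j,0}^+,x_{j,0}^-,x_{j,1}^+,x_{j,1}^-\}$, and $c_n^*(A)=\dim_F P_n^*/(P_n^*\cap \mathrm{Id}^*(A))$. Quadratic codimension growth means $\lim_{n\to\infty}c_n^*(A)/(\alpha n^2)=1$ for some $\alpha\ne0$. A multilinear polynomial is proper if it is a linear combination of products of variables from $X_0^-$, then variables from $X_1^+$, then variables from $X_1^-$, followed by (left-normed) commutators of length at least 2 in arbitrary variables. For $n=n_1+\cdots+n_4$, $\Gamma_{n_1,\dots,n_4}$ is the space of proper multilinear polynomials of degree $n$ in which the first $n_1$ variables are symmetric of degree 0, the next $n_2$ skew of degree 0, the next $n_3$ symmetric of degree 1, the last $n_4$ skew of degree 1. The group $S_{n_1}\times\cdots\times S_{n_4}$ acts by permuting variables of the same type, and the character of $\Gamma_{n_1,\dots,n_4}(A)=\Gamma_{n_1,\dots,n_4}/(\Gamma_{n_1,\dots,n_4}\cap\mathrm{Id}^*(A))$ decomposes as $\pi_{n_1,\dots,n_4}(A)=\sum m_{\lambda_1,\dots,\lambda_4}\,\chi_{\lambda_1}\otimes\cdots\otimes\chi_{\lambda_4}$,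 summed over $\lambda_i\vdash n_i$ (the proper cocharacter of $A$). A multipartition is written $((\lambda_1)_{0^+},(\lambda_2)_{0^-},(\lambda_3)_{1^+},(\lambda_4)_{1^-})$ with empty partitions omitted; e.g. $m_{((1)_{0^+},(1)_{1^+})}$ is the multiplicity for $(n_1,\dots,n_4)=(1,0,1,0)$ and $\lambda_1=\lambda_3=(1)$. Algebras: inside the $6\times6$ upper triangular matrices ($e_{ij}$ matrix units, $I_6$ identity), with $E=e_{23}+e_{45}$, put $N_3=\mathrm{span}\{I_6,E,e_{12}-e_{56},e_{13},e_{46}\}$ and $U_3=\mathrm{span}\{I_6,E,e_{12}+e_{56},e_{13},e_{46}\}$. The reflection superinvolution is $e_{ij}\mapsto e_{7-j,7-i}$. $N_{3,*}$ is $N_3$ with trivial grading and reflection superinvolution. $N_{3,*}^{gri},U_{3,*}^{gri}$ are $N_3,U_3$ with reflection superinvolution and the elementary grading induced by $(g_1,\dots,g_6)=(0,1,1,0,0,1)$, i.e. $e_{ij}$ has degree $g_i+g_j\bmod 2$. *)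

(* Defs.v *)
From HB Require Import structures.
From mathcomp Require Import all_boot all_order all_algebra all_fingroup.
From mathcomp Require Import falgebra mxrepresentation.
From mathcomp Require Import boolp classical_sets reals topology normedtype.
From mathcomp Require Import sequences.
From mathcomp Require Import -(notations) monalg.
From mathcomp Require Import zify.

Set Implicit Arguments.
Unset Strict Implicit.
Unset Printing Implicit Defensive.

Import Order.TTheory GRing.Theory Num.Theory.
Import numFieldNormedType.Exports.

Local Open Scope ring_scope.

(* A degree is a boolean: false stands for 0, true for 1, and (+) is addition
   mod 2. *)
Record starAlg (F : fieldType) := StarAlg {
  star_sort :> algType F;
  homog : bool -> star_sort -> Prop;
  star : star_sort -> star_sort;
  homog0 : forall i, homog i 0;
  homogP : forall i (c : F) a b, homog i a -> homog i b -> homog i (c *: a + b);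
  homog_sum : forall a, exists a0 a1,
    [/\ homog false a0, homog true a1 & a = a0 + a1];
  homog_cap : forall a, homog false a -> homog true a -> a = 0;
  homogM : forall i j a b, homog i a -> homog j b -> homog (i (+) j) (a * b);
  starP : forall (c : F) a b, star (c *: a + b) = c *: star a + star b;
  star_homog : forall i a, homog i a -> homog i (star a);
  starK : involutive star;
  starM : forall i j a b, homog i a -> homog j b ->
    star (a * b) = (-1) ^+ (i && j) *: (star b * star a)
}.

(* A_i^+ (e = false) and A_i^- (e = true). *)
Definition sym_part (F : fieldType) (A : starAlg F) (i e : bool) (a : A) : Prop :=
  homog i a /\ star a = (-1) ^+ e *: a.

Section Jacobson.
Variable R : nzRingType.
Implicit Types I K : R -> Prop.

Definition left_ideal I : Prop :=
  [/\ I 0, forall x y, I x -> I y -> I (x + y) & forall a x, I x -> I (a * x)].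

Definition maximal_left_ideal I : Prop :=
  [/\ left_ideal I, ~ I 1 &
      forall K, left_ideal K -> ~ K 1 -> (forall x, I x -> K x) ->
        forall x, K x -> I x].

Definition jacobson (x : R) : Prop := forall I, maximal_left_ideal I -> I x.
End Jacobson.

Definition type_FJ (F : fieldType) (A : starAlg F) : Prop :=
  forall a : A, exists (c : F) (x : A), jacobson x /\ a = c%:A + x.

(* The variable x_{j,i}^e is ((i, e), j), with e = true for skew variables;
   indices j start from 0. *)
Definition kind := (bool * bool)%type.
Definition even_sym : kind := (false, false).
Definition even_skew : kind := (false, true).
Definition odd_sym : kind := (true, false).
Definition odd_skew : kind := (true, true).

Definition Xvar := (kind * nat)%type.

Definition freeAlg (F : fieldType) : lalgType F := malg (fmonom Xvar) F.

Definition xvar (F : fieldType) (x : Xvar) : freeAlg F := mkmalgU (fmu x) 1.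

Definition subst (F : fieldType) (A : lalgType F) (phi : Xvar -> A)
    (f : freeAlg F) : A :=
  mmap (in_alg A) (fun m : fmonom Xvar => \prod_(x <- (m : seq Xvar)) phi x) f.

Definition Idstar (F : fieldType) (A : starAlg F) (f : freeAlg F) : Prop :=
  forall phi : Xvar -> A,
    (forall i e j, sym_part i e (phi ((i, e), j))) -> subst phi f = 0.

Definition in_var (F : fieldType) (A B : starAlg F) : Prop :=
  forall f : freeAlg F, Idstar A f -> Idstar B f.

Section Quotients.
Variables (F : fieldType) (V : lmodType F).
Implicit Types U W S : V -> Prop.

Definition lspan S (v : V) : Prop :=
  exists (d : nat) (c : 'I_d -> F) (u : 'I_d -> V),
    (forall i, S (u i)) /\ v = \sum_i c i *: u i.

Definition basis_mod U W d (b : 'I_d -> V) : Prop :=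
  [/\ forall i, U (b i),
      forall c : 'I_d -> F, W (\sum_i c i *: b i) -> forall i, c i = 0 &
      forall u, U u -> exists c : 'I_d -> F, W (u - \sum_i c i *: b i)].

(* The dimension of U / (U \cap W). *)
Definition qdim U W : nat :=
  xget 0%N [set d : nat | exists b : 'I_d -> V, basis_mod U W b]%classic.

(* The trace of the endomorphism of U / (U \cap W) induced by f. *)
Definition qtrace U W (f : V -> V) : F :=
  xget 0 [set t : F | exists (d : nat) (b : 'I_d -> V) (M : 'M[F]_d),
    [/\ basis_mod U W b, forall j, W (f (b j) - \sum_i M i j *: b i)
      & t = \tr M]]%classic.

Definition subspace W : Prop :=
  W 0 /\ forall (c : F) x y, W x -> W y -> W (c *: x + y).

Section Uniqueness.
Variables (U W : V -> Prop) (sW : subspace W).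

Lemma subspaceZ c x : W x -> W (c *: x).
Proof. by case: sW => W0 Wl Wx; rewrite -[_ *: _]addr0; apply: Wl. Qed.

Lemma subspaceD x y : W x -> W y -> W (x + y).
Proof. by case: sW => _ Wl Wx; rewrite -[x]scale1r; apply: Wl. Qed.

Lemma subspace_sum (I : finType) (x : I -> V) :
  (forall i, W (x i)) -> W (\sum_i x i).
Proof.
by move=> Wx; apply: big_ind => //; [case: sW | apply: subspaceD].
Qed.

Let comb m n (M : 'M[F]_(m, n)) (b : 'I_n -> V) i := \sum_j M i j *: b j.
Let cong m (b b' : 'I_m -> V) := forall i, W (b i - b' i).

Lemma cong_trans m (b1 b2 b3 : 'I_m -> V) :
  cong b1 b2 -> cong b2 b3 -> cong b1 b3.
Proof. by move=> h h' i; rewrite -(subrK (b2 i) (b1 i)) -addrA; apply: subspaceD. Qed.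

Lemma cong_comb m n (M : 'M_(m, n)) b b' : cong b b' -> cong (comb M b) (comb M b').
Proof.
move=> h i; rewrite /comb -sumrB; apply: subspace_sum => j.
by rewrite -scalerBr; apply: subspaceZ.
Qed.

Lemma comb_mul m n p (M : 'M_(m, n)) (N : 'M_(n, p)) b :
  comb (M *m N) b =1 comb M (comb N b).
Proof.
move=> i; rewrite /comb.
under [RHS]eq_bigr => j _ do rewrite scaler_sumr.
rewrite exchange_big; apply: eq_bigr => k _.
by rewrite mxE scaler_suml; apply: eq_bigr => j _; rewrite scalerA.
Qed.

Lemma comb1 m (b : 'I_m -> V) : comb 1%:M b =1 b.
Proof.
move=> i; rewrite /comb (bigD1 i) //= mxE eqxx scale1r big1 ?addr0 // => j ji.
by rewrite mxE eq_sym (negPf ji) scale0r.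
Qed.

Lemma basis_comb_inj m n (M N : 'M_(m, n)) b : basis_mod U W b ->
  cong (comb M b) (comb N b) -> M = N.
Proof.
case=> _ free _ h; apply/matrixP=> i j; apply/eqP; rewrite -subr_eq0; apply/eqP.
move: j; apply: free; under eq_bigr => j _ do rewrite scalerBl.
by rewrite sumrB; apply: h.
Qed.

Lemma basis_change d d' (b : 'I_d -> V) (b' : 'I_d' -> V) :
  basis_mod U W b -> basis_mod U W b' ->
  exists P : 'M[F]_(d', d), cong b' (comb P b).
Proof.
case=> _ _ gen [Ub' _ _].
have /fin_all_exists[P hP] j := gen _ (Ub' j).
by exists (\matrix_(j, i) P j i) => j; rewrite /comb;
  under eq_bigr => i _ do rewrite mxE.
Qed.

Lemma basis_change_mul d d' (b : 'I_d -> V) (b' : 'I_d' -> V)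
    (P : 'M_(d', d)) (Q : 'M_(d, d')) : basis_mod U W b ->
  cong b' (comb P b) -> cong b (comb Q b') -> Q *m P = 1%:M.
Proof.
move=> bb hP hQ; apply: (basis_comb_inj bb) => i.
have := cong_comb Q hP i => h; have := cong_trans hQ (cong_comb Q hP) i.
rewrite comb1 comb_mul => h'.
by rewrite -opprB -scaleN1r; apply: subspaceZ.
Qed.

Lemma basis_mod_size d d' (b : 'I_d -> V) (b' : 'I_d' -> V) :
  basis_mod U W b -> basis_mod U W b' -> d = d'.
Proof.
move=> hb hb'; have [P hP] := basis_change hb hb'.
have [Q hQ] := basis_change hb' hb.
have := mulmx_max_rank Q P; have := mulmx_max_rank P Q.
rewrite (basis_change_mul hb hP hQ) (basis_change_mul hb' hQ hP) !mxrank1.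
by move=> le1 le2; apply/eqP; rewrite eqn_leq le1 le2.
Qed.

Lemma qdimE d (b : 'I_d -> V) : basis_mod U W b -> qdim U W = d.
Proof.
move=> hb; rewrite /qdim; case: xgetP => [_ -> [b' hb']|/(_ d)[]].
  exact: basis_mod_size hb' hb.
by exists b.
Qed.

Lemma qtraceE f d (b : 'I_d -> V) (M : 'M_d) :
  linear f -> (forall x, W x -> W (f x)) ->
  basis_mod U W b -> (forall j, W (f (b j) - \sum_i M i j *: b i)) ->
  qtrace U W f = \tr M.
Proof.
move=> lf fW hb hM; rewrite /qtrace.
case: xgetP => [_ -> [d' [b' [M' [hb' hM' ->]]]]|/(_ (\tr M))[]]; last first.
  by exists d, b, M; split.
have [P hP] := basis_change hb hb'; have [Q hQ] := basis_change hb' hb.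
have f0 : f 0 = 0 by apply: (addrI (f 0)); rewrite -{1}[f 0]scale1r -lf addr0 scaler0 addr0.
have fZ c x : f (c *: x) = c *: f x by rewrite -[c *: x]addr0 lf f0 addr0.
have fD x y : f (x + y) = f x + f y by rewrite -{1}[x]scale1r lf scale1r.
have fcomb m n (N : 'M_(m, n)) c i : f (comb N c i) = comb N (f \o c) i.
  rewrite /comb (big_morph f fD f0).
  by apply: eq_bigr => j _; rewrite fZ.
have hMT : cong (f \o b) (comb M^T b).
  move=> j; rewrite /comb; under eq_bigr => i _ do rewrite mxE.
  exact: hM.
have hMT' : cong (f \o b') (comb M'^T b').
  move=> j; rewrite /comb; under eq_bigr => i _ do rewrite mxE.
  exact: hM'.
have fP : cong (f \o b') (comb P (f \o b)).
  move=> i; rewrite -fcomb /= -scaleN1r -fZ -fD scaleN1r; exact/fW/hP.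
have key : cong (f \o b') (comb (P *m (M^T *m Q)) b').
  apply: cong_trans fP _; apply: cong_trans (cong_comb P hMT) _.
  move=> i; rewrite comb_mul; move: i; apply: cong_comb => i.
  by rewrite comb_mul; move: i; apply: cong_comb.
have -> : M' = (P *m (M^T *m Q))^T.
  apply: trmx_inj; rewrite trmxK; apply: (basis_comb_inj hb').
  apply: cong_trans key => i; rewrite -opprB -scaleN1r; apply: subspaceZ.
  exact: hMT'.
rewrite mxtrace_tr mxtrace_mulC -mulmxA (basis_change_mul hb hP hQ) mulmx1.
exact: mxtrace_tr.
Qed.
End Uniqueness.
End Quotients.

Section Codimensions.
Variable F : fieldType.

Definition Pn_monomial n (u : freeAlg F) : Prop :=
  exists (s : 'S_n) (k : 'I_n -> kind),
    u = \prod_(j < n) xvar F (k (s j), s j : nat).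

Definition Pn n : freeAlg F -> Prop := lspan (Pn_monomial n).

Definition codim (A : starAlg F) n : nat := qdim (Pn n) (Idstar A).

Local Open Scope classical_set_scope.

(* R is the field of real numbers. *)
Definition quadratic_growth (R : realType) (A : starAlg F) : Prop :=
  exists alpha : R, alpha != 0 /\
    ((codim A n)%:R / (alpha * n%:R ^+ 2) @[n --> \oo] --> (1 : R)).
End Codimensions.

Section Proper.
Variable F : fieldType.

Definition lcommutator (c : seq Xvar) : freeAlg F :=
  if c is x :: s then
    foldl (fun u y => u * xvar F y - xvar F y * u) (xvar F x) s
  else 0.

Definition Gamma_vars (n1 n2 n3 n4 : nat) : seq Xvar :=
  [seq (even_sym, j) | j <- iota 0 n1] ++
  [seq (even_skew, j) | j <- iota n1 n2] ++
  [seq (odd_sym, j) | j <- iota (n1 + n2) n3] ++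
  [seq (odd_skew, j) | j <- iota (n1 + n2 + n3) n4].

Definition proper_product n1 n2 n3 n4 (u : freeAlg F) : Prop :=
  exists (ys zs ws : seq Xvar) (cs : seq (seq Xvar)),
    [/\ all (fun x => x.1 == even_skew) ys,
        all (fun x => x.1 == odd_sym) zs,
        all (fun x => x.1 == odd_skew) ws,
        all (fun c => 1 < size c)%N cs
      & perm_eq (ys ++ zs ++ ws ++ flatten cs) (Gamma_vars n1 n2 n3 n4)
     /\ u = \prod_(x <- ys) xvar F x * \prod_(x <- zs) xvar F x *
            \prod_(x <- ws) xvar F x * \prod_(c <- cs) lcommutator c].

Definition Gamma n1 n2 n3 n4 : freeAlg F -> Prop :=
  lspan (proper_product n1 n2 n3 n4).

(* A permutation of {0,..,n-1}, acting on the block {o,..,o+n-1}. *)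
Definition block_perm (o n : nat) (s : 'S_n) (j : nat) : nat :=
  if (o <= j)%N then
    if insub (j - o)%N is Some i then (o + s i)%N else j
  else j.

Definition rename n1 n2 n3 n4 (s1 : 'S_n1) (s2 : 'S_n2) (s3 : 'S_n3)
    (s4 : 'S_n4) (x : Xvar) : Xvar :=
  (x.1, match x.1 with
        | (false, false) => block_perm 0 s1 x.2
        | (false, true) => block_perm n1 s2 x.2
        | (true, false) => block_perm (n1 + n2) s3 x.2
        | (true, true) => block_perm (n1 + n2 + n3) s4 x.2
        end).

Definition proper_character (A : starAlg F) n1 n2 n3 n4 (s1 : 'S_n1)
    (s2 : 'S_n2) (s3 : 'S_n3) (s4 : 'S_n4) : F :=
  qtrace (Gamma n1 n2 n3 n4) (Idstar A)
    (subst (fun x => xvar F (rename s1 s2 s3 s4 x))).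
End Proper.

Fixpoint bounded_partns (fuel m n : nat) : seq (seq nat) :=
  if n == 0%N then [:: [::]] else
  if fuel is f.+1 then
    flatten [seq [seq i :: l | l <- bounded_partns f i (n - i)]
            | i <- iota 1 (minn m n)]
  else [::].

Definition partns n : seq (seq nat) := bounded_partns n n n.

Lemma mem_bounded_partns fuel m n l : (n <= fuel)%N ->
  (l \in bounded_partns fuel m n) =
  [&& path geq m l, all (leq 1) l & sumn l == n].
Proof.
elim: fuel m n l => [|f IH] m [|n] l // lenf;
  try by rewrite inE; case: l => [|[|x] l] //=; rewrite ?andbF ?addSn ?andbF.
rewrite [bounded_partns _ _ _]/=; apply/flatten_mapP/idP => [[i]|].
  rewrite mem_iota add1n ltnS leq_min => /and3P[i1 im iN] /mapP[l' + ->].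
  rewrite IH; last by lia.
  by case/and3P=> p a /eqP s; rewrite /= im p i1 a s subnKC ?eqxx.
case: l => [|x l] /=; first by [].
case/and3P=> /andP[xm p] /andP[x1 a] /eqP s; exists x.
  by rewrite mem_iota add1n ltnS leq_min x1 xm -s leq_addr.
by apply: map_f; rewrite IH ?p ?a; lia.
Qed.

Lemma mem_partns n l :
  (l \in partns n) = [&& sorted geq l, all (leq 1) l & sumn l == n].
Proof.
rewrite mem_bounded_partns //; case: l => [|x l] //=.
case: (x + sumn l =P n)%N => [<-|]; last by rewrite !andbF.
by rewrite leq_addr.
Qed.

Lemma uniq_bounded_partns fuel m n : uniq (bounded_partns fuel m n).
Proof.
elim: fuel m n => [|f IH] m [|n] //=.
elim: {1}(minn m n.+1) 1%N => [|k IHk] j //=.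
rewrite cat_uniq IHk map_inj_uniq ?IH ?andbT => [|? ? []//].
apply/hasPn => l /flatten_mapP[i]; rewrite mem_iota => /andP[ji _].
case/mapP=> l1 _ ->; apply/mapP=> -[l2 _ [eij _]]; lia.
Qed.

Lemma uniq_partns n : uniq (partns n).
Proof. exact: uniq_bounded_partns. Qed.

Section Characters.
Variables (F : fieldType) (n : nat) (l : seq nat).

(* The Young tableau of shape l containing 0, 1, .., n-1 in this order, row by
   row: the entry i is in row reshape_index l i and column reshape_offset l i. *)
Definition row_stab : {set 'S_n} :=
  [set s : 'S_n | [forall i, reshape_index l (s i) == reshape_index l i]].
Definition col_stab : {set 'S_n} :=
  [set s : 'S_n | [forall i, reshape_offset l (s i) == reshape_offset l i]].

Definition young_symmetrizer : 'M[F]_#|[set: 'S_n]| :=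
  \sum_(s in row_stab) \sum_(t in col_stab)
    (-1) ^+ t *: regular_repr F [set: 'S_n]%G (s * t)%g.

(* The trace on the right ideal of F S_n generated by the symmetrizer; gring_row
   turns the matrix of an element of F S_n in the regular representation into
   the row vector of its coefficients. *)
Definition irr_char (s : 'S_n) : F :=
  \tr (submod_repr (cyclic_mx_module (regular_repr F [set: 'S_n]%G)
                      (gring_row young_symmetrizer)) s).
End Characters.

Definition cochar_decomposition (F : fieldType) (A : starAlg F) n1 n2 n3 n4
    (m : seq nat -> seq nat -> seq nat -> seq nat -> nat) : Prop :=
  forall (s1 : 'S_n1) (s2 : 'S_n2) (s3 : 'S_n3) (s4 : 'S_n4),
    proper_character A s1 s2 s3 s4 =
    \sum_(l1 <- partns n1) \sum_(l2 <- partns n2)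
    \sum_(l3 <- partns n3) \sum_(l4 <- partns n4)
      (m l1 l2 l3 l4)%:R * (irr_char F l1 s1 * irr_char F l2 s2 *
                            irr_char F l3 s3 * irr_char F l4 s4).

(* Only the values of m at partitions of n1, .., n4 are determined by
   cochar_decomposition, and mult reads m at such a place. *)
Definition mult (F : fieldType) (A : starAlg F) (l1 l2 l3 l4 : seq nat) : nat :=
  xget (fun _ _ _ _ => 0%N)
    [set m | cochar_decomposition A (sumn l1) (sumn l2) (sumn l3) (sumn l4) m]%classic
    l1 l2 l3 l4.

Section Examples.
Variable F : fieldType.

(* The matrix unit e_{ij}, with i and j counted from 1. *)
Definition eu (i j : nat) : 'M[F]_6 := delta_mx (inord i.-1) (inord j.-1).
Definition matE : 'M[F]_6 := eu 2 3 + eu 4 5.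

Definition N3_space : {vspace 'M[F]_6} :=
  <<[:: 1; matE; eu 1 2 - eu 5 6; eu 1 3; eu 4 6]%R>>%VS.
Definition U3_space : {vspace 'M[F]_6} :=
  <<[:: 1; matE; eu 1 2 + eu 5 6; eu 1 3; eu 4 6]%R>>%VS.

Definition reflection (x : 'M[F]_6) : 'M[F]_6 :=
  \matrix_(i, j) x (rev_ord j) (rev_ord i).

Lemma reflection_eu i j : (0 < i <= 6)%N -> (0 < j <= 6)%N ->
  reflection (eu i j) = eu (7 - j) (7 - i).
Proof.
move=> hi hj; apply/matrixP=> p q; rewrite !mxE.
rewrite -!(inj_eq val_inj) /= !inordK; try lia.
congr (nat_of_bool _)%:R; have := ltn_ord p; have := ltn_ord q; lia.
Qed.

(* (g_1, .., g_6) *)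
Definition g6 : seq bool := [:: false; true; true; false; false; true].

Definition elementary_homog (i : bool) (x : 'M[F]_6) : Prop :=
  forall p q : 'I_6, x p q != 0 -> nth false g6 p (+) nth false g6 q = i.

Lemma eu_elementary_homog i j : (0 < i <= 6)%N -> (0 < j <= 6)%N ->
  elementary_homog (nth false g6 i.-1 (+) nth false g6 j.-1) (eu i j).
Proof.
move=> hi hj p q; rewrite mxE; case: andP => [[/eqP-> /eqP->] _|]; last first.
  by rewrite eqxx.
by rewrite !inordK //; lia.
Qed.

Lemma mul_eu i j k l : (0 < i <= 6)%N -> (0 < j <= 6)%N ->
  (0 < k <= 6)%N -> (0 < l <= 6)%N ->
  eu i j * eu k l = if j == k then eu i l else 0.
Proof.
move=> hi hj hk hl; rewrite /eu -mulmxE mul_delta_mx_cond.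
rewrite -(inj_eq val_inj) /= !inordK; try lia.
have ->: (j.-1 == k.-1) = (j == k) by lia.
by case: eqP.
Qed.

Lemma reflection1 : reflection 1 = 1.
Proof.
apply/matrixP=> p q; rewrite !mxE (inj_eq rev_ord_inj) eq_sym.
by [].
Qed.

Lemma reflectionP c x y :
  reflection (c *: x + y) = c *: reflection x + reflection y.
Proof. by apply/matrixP=> p q; rewrite !mxE. Qed.

Lemma reflection0 : reflection 0 = 0.
Proof. by apply/matrixP=> p q; rewrite !mxE. Qed.

Lemma reflectionK : involutive reflection.
Proof. by move=> x; apply/matrixP=> p q; rewrite !mxE !rev_ordK. Qed.

Lemma reflectionM x y : reflection (x * y) = reflection y * reflection x.
Proof.
apply/matrixP=> p q; rewrite -!mulmxE !mxE (reindex_inj rev_ord_inj).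
by apply: eq_bigr => k _; rewrite !mxE mulrC.
Qed.

Lemma reflection_homog i x :
  elementary_homog i x -> elementary_homog i (reflection x).
Proof.
move=> hx p q; rewrite mxE => /hx <-; rewrite addbC /=.
by case: p q => [[|[|[|[|[|[|p]]]]]] // ?] [[|[|[|[|[|[|q]]]]]] // ?].
Qed.

Lemma span_ind (P : 'M[F]_6 -> Prop) X : P 0 ->
  (forall c x y, P x -> P y -> P (c *: x + y)) ->
  (forall x, x \in X -> P x) -> forall v, v \in <<X>>%VS -> P v.
Proof.
move=> P0 Pl PX v Xv; rewrite (coord_span (X := in_tuple X) Xv).
apply: big_ind => // [x y Px Py|i _].
  by rewrite -[x]scale1r; apply: Pl.
by rewrite -[_ *: _]addr0; apply: Pl => //; apply/PX/mem_nth.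
Qed.

Section Closure.
Variables (c : F).
Let X := [:: 1; matE; eu 1 2 + c *: eu 5 6; eu 1 3; eu 4 6].
Let U := <<X>>%VS.

Lemma gens_mul x y : x \in U -> y \in U -> x * y \in U.
Proof.
move=> Ux Uy; move: x Ux.
apply: span_ind => [|a x x' Hx Hx'|x Xx]; first by rewrite mul0r mem0v.
  by rewrite mulrDl -scalerAl memvD ?memvZ.
move: y Uy; apply: span_ind => [|a y y' Hy Hy'|y Xy].
- by rewrite mulr0 mem0v.
- by rewrite mulrDr -scalerAr memvD ?memvZ.
have inU : {subset X <= U} by move=> z /memv_span.
have h13 : eu 1 3 \in U by rewrite inU ?inE ?eqxx ?orbT.
have h46 : eu 4 6 \in U by rewrite inU ?inE ?eqxx ?orbT.
have [->|x1] := eqVneq x 1; first by rewrite mul1r inU.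
have [->|y1] := eqVneq y 1; first by rewrite mulr1 inU.
move: Xx Xy; rewrite !inE (negPf x1) (negPf y1) /=.
case/or4P=> /eqP->; case/or4P=> /eqP->;
  by rewrite /matE
    ?(mulrDl, mulrDr) -?scalerAl -?scalerAr ?mul_eu //=
    ?(scaler0, addr0, add0r) ?mem0v ?memvZ.
Qed.

Lemma gens1 : 1 \in U.
Proof. by rewrite memv_span ?mem_head. Qed.

Lemma gens_refl x : c ^+ 2 = 1 -> x \in U -> reflection x \in U.
Proof.
move=> c2; move: x.
apply: span_ind => [|a x y Hx Hy|x].
- by rewrite reflection0 mem0v.
- by rewrite reflectionP memvD ?memvZ.
have inU : {subset X <= U} by move=> z /memv_span.
have rZ a z : reflection (a *: z) = a *: reflection z.
  by rewrite -[a *: z]addr0 reflectionP reflection0 addr0.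
have rD y z : reflection (y + z) = reflection y + reflection z.
  by rewrite -[y in LHS]scale1r reflectionP scale1r.
rewrite !inE.
case/or4P=> [/eqP->|/eqP->|/eqP->|/orP[/eqP->|/eqP->]];
  rewrite /matE ?rD ?rZ ?reflection1 ?reflection_eu //= ?gens1 //.
- by rewrite addrC inU // !inE eqxx orbT.
- have ->: eu 5 6 + c *: eu 1 2 = c *: (eu 1 2 + c *: eu 5 6).
    by rewrite scalerDr scalerA -expr2 c2 scale1r addrC.
  by rewrite memvZ // inU // !inE eqxx !orbT.
- by rewrite inU // !inE eqxx !orbT.
- by rewrite inU // !inE eqxx !orbT.
Qed.

Definition part (i : bool) (x : 'M[F]_6) : 'M[F]_6 :=
  \matrix_(p, q) if nth false g6 p (+) nth false g6 q == i then x p q else 0.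

Lemma partP i a x y : part i (a *: x + y) = a *: part i x + part i y.
Proof.
by apply/matrixP=> p q; rewrite !mxE; case: ifP; rewrite // mulr0 addr0.
Qed.

Lemma part0 i : part i 0 = 0.
Proof. by apply/matrixP=> p q; rewrite !mxE if_same. Qed.

Lemma part_homog i x : elementary_homog i (part i x).
Proof. by move=> p q; rewrite mxE; case: ifP => [/eqP//|]; rewrite eqxx. Qed.

Lemma part_sum x : x = part false x + part true x.
Proof.
by apply/matrixP=> p q; rewrite !mxE; case: addb; rewrite /= ?addr0 ?add0r.
Qed.

Lemma homog_part d i x :
  elementary_homog d x -> part i x = if d == i then x else 0.
Proof.
move=> hx; apply/matrixP=> p q; rewrite mxE; have := hx p q.
case: (eqVneq (x p q) 0) => [x0 _|_ /(_ isT)->].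
  by case: ifP => _; case: (d == i); rewrite ?mxE.
by case: (d == i); rewrite ?mxE.
Qed.

Lemma elementary_homogP i a x y : elementary_homog i x ->
  elementary_homog i y -> elementary_homog i (a *: x + y).
Proof.
move=> hx hy p q; rewrite !mxE; case: (eqVneq (x p q) 0) => [->|/hx//].
by rewrite mulr0 add0r => /hy.
Qed.

Lemma elementary_homog0 i : elementary_homog i 0.
Proof. by move=> p q; rewrite mxE eqxx. Qed.

Lemma elementary_homogM i j x y : elementary_homog i x ->
  elementary_homog j y -> elementary_homog (i (+) j) (x * y).
Proof.
move=> hx hy p q; rewrite -mulmxE mxE => xy0.
have [k xyk|xy0'] := pickP (fun k => x p k * y k q != 0); last first.
  by case/eqP: xy0; apply: big1 => k _; apply/eqP/negPn; rewrite xy0'.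
move: xyk; rewrite mulf_eq0 negb_or => /andP[/hx <- /hy <-].
by rewrite addbA addbK.
Qed.

Lemma homog_eu d i j : (0 < i <= 6)%N -> (0 < j <= 6)%N ->
  nth false g6 i.-1 (+) nth false g6 j.-1 = d -> elementary_homog d (eu i j).
Proof. by move=> hi hj <-; apply: eu_elementary_homog. Qed.

Lemma homog_gens x : x \in X -> x \in [:: 1; matE] \/ elementary_homog true x.
Proof.
rewrite !inE => /or4P[/eqP->|/eqP->|/eqP->|/orP[/eqP->|/eqP->]];
  rewrite ?eqxx ?orbT; try (by left); right; try exact: homog_eu.
by rewrite addrC; apply: elementary_homogP; apply: homog_eu.
Qed.

Lemma homog_gens0 x : x \in [:: 1; matE] -> elementary_homog false x.
Proof.
rewrite !inE => /orP[] /eqP->; last first.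
  by rewrite -[matE]/(_ + _) -[eu 2 3]scale1r; apply: elementary_homogP;
     apply: homog_eu.
move=> p q; rewrite mxE; case: (p =P q) => [->|_]; first by rewrite addbb.
by rewrite eqxx.
Qed.

Lemma part_gens i x : x \in U -> part i x \in U.
Proof.
move: x; apply: span_ind => [|a x y Hx Hy|x Xx].
- by rewrite part0 mem0v.
- by rewrite partP memvD ?memvZ.
have Ux : x \in U by rewrite memv_span.
case: (homog_gens Xx) => [/homog_gens0|] hx; rewrite (homog_part i hx);
  by case: ifP; rewrite ?mem0v.
Qed.

Lemma odd_mul0 x y : x \in U -> y \in U -> elementary_homog true x ->
  elementary_homog true y -> x * y = 0.
Proof.
move=> Ux Uy hx hy.
have <- : part true x = x by rewrite (homog_part _ hx).
have <- : part true y = y by rewrite (homog_part _ hy).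
move: x Ux {hx}; apply: span_ind => [|a x x' Hx Hx'|x Xx].
- by rewrite part0 mul0r.
- by rewrite partP mulrDl -scalerAl Hx Hx' scaler0 addr0.
move: y Uy {hy}; apply: span_ind => [|a y y' Hy Hy'|y Xy].
- by rewrite part0 mulr0.
- by rewrite partP mulrDr -scalerAr Hy Hy' scaler0 addr0.
case: (boolP (x \in [:: 1; matE])) => [/homog_gens0 hx|x0].
  by rewrite (homog_part true hx) /= mul0r.
case: (boolP (y \in [:: 1; matE])) => [/homog_gens0 hy|y0].
  by rewrite (homog_part true hy) /= mulr0.
case: (homog_gens Xx) => [x0'|hx]; first by rewrite x0' in x0.
case: (homog_gens Xy) => [y0'|hy]; first by rewrite y0' in y0.
rewrite (homog_part true hx) (homog_part true hy) /=.
move: Xx Xy x0 y0; rewrite !inE.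
case/or4P=> [->|->|/eqP->|/orP[/eqP->|/eqP->]]; rewrite ?orbT //;
case/or4P=> [->|->|/eqP->|/orP[/eqP->|/eqP->]]; rewrite ?orbT // => _ _;
  by rewrite ?(mulrDl, mulrDr) -?scalerAl -?scalerAr ?mul_eu //=
    ?(scaler0, addr0).
Qed.

Lemma gens_aspace : is_aspace U.
Proof.
rewrite /is_aspace has_algid1 ?gens1 //=.
by apply/prodvP => x y; apply: gens_mul.
Qed.
End Closure.

Lemma N3_spaceE : N3_space =
  <<[:: 1; matE; eu 1 2 + -1 *: eu 5 6; eu 1 3; eu 4 6]%R>>%VS.
Proof. by rewrite scaleN1r. Qed.

Lemma U3_spaceE : U3_space =
  <<[:: 1; matE; eu 1 2 + 1 *: eu 5 6; eu 1 3; eu 4 6]%R>>%VS.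
Proof. by rewrite scale1r. Qed.

Lemma N3_is_aspace : is_aspace N3_space.
Proof. by rewrite N3_spaceE; apply: gens_aspace. Qed.

Lemma U3_is_aspace : is_aspace U3_space.
Proof. by rewrite U3_spaceE; apply: gens_aspace. Qed.

Definition N3 : {aspace 'M[F]_6} := ASpace N3_is_aspace.
Definition U3 : {aspace 'M[F]_6} := ASpace U3_is_aspace.

(* The unit of subvs_of B, which is algid B by definition, is I_6. *)
Lemma N3_unit : vsval (1 : subvs_of N3) = 1.
Proof. by apply/eqP; rewrite algid_eq1 /= N3_spaceE gens1. Qed.

Lemma U3_unit : vsval (1 : subvs_of U3) = 1.
Proof. by apply/eqP; rewrite algid_eq1 /= U3_spaceE gens1. Qed.

Section Superinvolution.
Variable B : {aspace 'M[F]_6}.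
Implicit Types a b : subvs_of B.

Definition sub_star a : subvs_of B := vsproj B (reflection (vsval a)).

Definition trivial_grading (i : bool) a : Prop := i -> a = 0.
Definition elementary_grading (i : bool) a : Prop :=
  elementary_homog i (vsval a).

Hypothesis BR : forall x, x \in B -> reflection x \in B.

Lemma vsval_star a : vsval (sub_star a) = reflection (vsval a).
Proof. by rewrite vsprojK // BR // subvsP. Qed.

Lemma sub_starP c a b : sub_star (c *: a + b) = c *: sub_star a + sub_star b.
Proof.
by apply: val_inj; rewrite /= [LHS]vsval_star !vsval_star -reflectionP.
Qed.

Lemma sub_starK : involutive sub_star.
Proof. by move=> a; apply: val_inj; rewrite /= !vsval_star reflectionK. Qed.

Lemma sub_starM a b : sub_star (a * b) = sub_star b * sub_star a.
Proof.
by apply: val_inj; rewrite /= [LHS]vsval_star !vsval_star -reflectionM.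
Qed.

Lemma trivial0 i : trivial_grading i 0.
Proof. by []. Qed.

Lemma trivialP i (c : F) a b : trivial_grading i a -> trivial_grading i b ->
  trivial_grading i (c *: a + b).
Proof. by move=> ha hb hi; rewrite ha ?hb // scaler0 addr0. Qed.

Lemma trivial_sum a : exists a0 a1,
  [/\ trivial_grading false a0, trivial_grading true a1 & a = a0 + a1].
Proof. by exists a, 0; rewrite addr0. Qed.

Lemma trivial_cap a : trivial_grading false a -> trivial_grading true a -> a = 0.
Proof. by move=> _ ->. Qed.

Lemma trivialM i j a b : trivial_grading i a -> trivial_grading j b ->
  trivial_grading (i (+) j) (a * b).
Proof.
move=> ha hb; case: i ha => ha; first by rewrite (ha isT) mul0r => _.
by move=> /= hj; rewrite hb // mulr0.
Qed.

Lemma trivial_star i a : trivial_grading i a -> trivial_grading i (sub_star a).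
Proof.
move=> ha hi; rewrite ha //; apply: val_inj.
by rewrite /= vsval_star /= reflection0.
Qed.

Lemma trivial_starM i j a b : trivial_grading i a -> trivial_grading j b ->
  sub_star (a * b) = (-1) ^+ (i && j) *: (sub_star b * sub_star a).
Proof.
move=> ha hb; rewrite sub_starM; case: i ha => ha; last by rewrite scale1r.
by rewrite (trivial_star ha) // mulr0 scaler0.
Qed.

Definition trivial_starAlg : starAlg F :=
  StarAlg trivial0 trivialP trivial_sum trivial_cap trivialM
    sub_starP trivial_star sub_starK trivial_starM.

Hypothesis Bpart : forall i x, x \in B -> part i x \in B.
Hypothesis Bodd : forall x y, x \in B -> y \in B -> elementary_homog true x ->
  elementary_homog true y -> x * y = 0.

Lemma elementary0 i : elementary_grading i 0.
Proof. exact: elementary_homog0. Qed.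

Lemma elementaryP i (c : F) a b : elementary_grading i a ->
  elementary_grading i b -> elementary_grading i (c *: a + b).
Proof. exact: elementary_homogP. Qed.

Lemma elementary_sum a : exists a0 a1,
  [/\ elementary_grading false a0, elementary_grading true a1 & a = a0 + a1].
Proof.
have partB i : part i (vsval a) \in B by rewrite Bpart ?subvsP.
exists (vsproj B (part false (vsval a))), (vsproj B (part true (vsval a))).
split; rewrite /elementary_grading ?vsprojK //; try exact: part_homog.
by apply: val_inj; rewrite /= !vsprojK // -part_sum.
Qed.

Lemma elementary_cap a :
  elementary_grading false a -> elementary_grading true a -> a = 0.
Proof.
move=> h0 h1; apply: val_inj => /=.
have := homog_part true h1; by rewrite (homog_part true h0) /= => <-.
Qed.

Lemma elementaryM i j a b : elementary_grading i a -> elementary_grading j b ->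
  elementary_grading (i (+) j) (a * b).
Proof. exact: elementary_homogM. Qed.

Lemma elementary_star i a :
  elementary_grading i a -> elementary_grading i (sub_star a).
Proof. by rewrite /elementary_grading vsval_star; apply: reflection_homog. Qed.

Lemma elementary_starM i j a b :
  elementary_grading i a -> elementary_grading j b ->
  sub_star (a * b) = (-1) ^+ (i && j) *: (sub_star b * sub_star a).
Proof.
move=> ha hb; rewrite sub_starM; case: andP => [[i1 j1]|_]; last first.
  by rewrite scale1r.
move: ha hb; rewrite i1 j1 => ha hb.
suff ->: sub_star b * sub_star a = 0 by rewrite scaler0.
by apply: val_inj; apply: Bodd; rewrite ?subvsP //; apply: elementary_star.
Qed.

Definition elementary_starAlg : starAlg F :=
  StarAlg elementary0 elementaryP elementary_sum elementary_cap elementaryM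
    sub_starP elementary_star sub_starK elementary_starM.
End Superinvolution.

Lemma N3_reflection x : x \in N3 -> reflection x \in N3.
Proof. by rewrite /= N3_spaceE; apply: gens_refl; rewrite sqrrN expr1n. Qed.

Lemma U3_reflection x : x \in U3 -> reflection x \in U3.
Proof. by rewrite /= U3_spaceE; apply: gens_refl; rewrite expr1n. Qed.

Lemma N3_part i x : x \in N3 -> part i x \in N3.
Proof. by rewrite /= N3_spaceE; apply: part_gens. Qed.

Lemma U3_part i x : x \in U3 -> part i x \in U3.
Proof. by rewrite /= U3_spaceE; apply: part_gens. Qed.

Lemma N3_odd x y : x \in N3 -> y \in N3 -> elementary_homog true x ->
  elementary_homog true y -> x * y = 0.
Proof. by rewrite /= N3_spaceE; apply: odd_mul0. Qed.

Lemma U3_odd x y : x \in U3 -> y \in U3 -> elementary_homog true x ->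
  elementary_homog true y -> x * y = 0.
Proof. by rewrite /= U3_spaceE; apply: odd_mul0. Qed.

Definition N3_star : starAlg F := trivial_starAlg N3_reflection.
Definition N3_star_gri : starAlg F :=
  elementary_starAlg N3_reflection N3_part N3_odd.
Definition U3_star_gri : starAlg F :=
  elementary_starAlg U3_reflection U3_part U3_odd.
End Examples.

(* Main.v *)
Require Import Defs.
From mathcomp Require Import all_boot all_order all_algebra reals.
From mathcomp Require Import all_fingroup falgebra mxrepresentation boolp.
From mathcomp Require Import classical_sets ring zify.
From mathcomp Require Import -(notations) finmap monalg.

(* The space of proper polynomials in question is spanned by one commutator
   [x, z], so the multiplicity is 1 or 0 according as [x, z] is not or is an
   identity of A.  The algebra B of the corresponding item does not satisfy
   [x, z], which gives one implication.  Conversely let [a, b] <> 0 in A.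
   B has nilpotent elements E and G with J(B)^3 = 0 and
   B = F + F E + F G + F [E, G] + F (EG + GE), where [E, G] has the type of
   [a, b], and EG + GE that of b.  The value of a polynomial f in B is
   hence given by the terms of order at most two of f around a scalar
   substitution.  If f vanishes on A then, F being infinite, so do these terms
   on A, and evaluating them at 1, a, b, [a, b] shows that every coordinate of
   the value of f in B is 0. *)

Set Implicit Arguments.
Unset Strict Implicit.
Unset Printing Implicit Defensive.

Import Order.TTheory GRing.Theory Num.Theory.

(** * Expansion of products along words to second order *)

Section WordExpansion.
Local Open Scope ring_scope.
Variables (X : Type).

(* word1 u v is the coefficient of t in the product of the u x + t * v x along
   the word; that of t * t' in the product of the u x + t * v1 x + t' * v2 x is
   word2 u v1 v2 (a v1 to the left of a v2) plus word2 u v2 v1. *)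
Fixpoint word1 (R : pzRingType) (u v : X -> R) (w : seq X) : R :=
  if w is x :: w' then v x * \prod_(y <- w') u y + u x * word1 u v w' else 0.

Fixpoint word2 (R : pzRingType) (u v1 v2 : X -> R) (w : seq X) : R :=
  if w is x :: w' then v1 x * word1 u v2 w' + u x * word2 u v1 v2 w' else 0.

Section Scalars.
Variables (F : fieldType) (A : algType F) (al : X -> F).

Lemma prod_scalar w : \prod_(x <- w) (al x)%:A = (\prod_(x <- w) al x)%:A :> A.
Proof.
elim: w => [|x w IH]; first by rewrite !big_nil scale1r.
by rewrite !big_cons IH -scalerAl mul1r scalerA.
Qed.

Lemma word1_scalar (be : X -> F) (a : A) w :
  word1 (fun x => (al x)%:A) (fun x => be x *: a) w = word1 al be w *: a.
Proof.
elim: w => [|x w IH] /=; first by rewrite scale0r.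
by rewrite IH prod_scalar -!scalerAl -scalerAr mulr1 mul1r !scalerA -scalerDl.
Qed.

Lemma word2_scalar (be ga : X -> F) (a b : A) w :
  word2 (fun x => (al x)%:A) (fun x => be x *: a) (fun x => ga x *: b) w =
  word2 al be ga w *: (a * b).
Proof.
elim: w => [|x w IH] /=; first by rewrite scale0r.
by rewrite IH word1_scalar -!scalerAl -scalerAr mul1r !scalerA -scalerDl.
Qed.

(** If [E] and [G] square to zero and [EGE = GEG = 0], the combinations of 1, [E], [G], [EG], [GE]
    are closed under products; this is their normal form. *)
Definition comb5 (E G : A) (p b g r s : F) : A :=
  p%:A + b *: E + g *: G + r *: (E * G) + s *: (G * E).

Lemma comb5D E G p b g r s p' b' g' r' s' :
  comb5 E G p b g r s + comb5 E G p' b' g' r' s' =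
  comb5 E G (p + p') (b + b') (g + g') (r + r') (s + s').
Proof.
rewrite /comb5 !scalerDl.
by do 4 (rewrite addrACA; congr (_ + _)).
Qed.

Lemma comb5Z E G c p b g r s :
  c *: comb5 E G p b g r s = comb5 E G (c * p) (c * b) (c * g) (c * r) (c * s).
Proof. by rewrite /comb5 !scalerDr !scalerA. Qed.

(* The nilpotent part cubes to zero, so the expansion stops at order two. *)
Lemma prod_word_expansion (E G : A) (be ga ze et : X -> F) w :
  E * E = 0 -> G * G = 0 -> E * G * E = 0 -> G * E * G = 0 ->
  \prod_(x <- w) comb5 E G (al x) (be x) (ga x) (et x + ze x) (et x - ze x) =
  comb5 E G (\prod_(x <- w) al x) (word1 al be w) (word1 al ga w)
    (word1 al et w + word1 al ze w + word2 al be ga w)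
    (word1 al et w - word1 al ze w + word2 al ga be w).
Proof.
move=> EE GG EGE GEG.
(* Left multiplication by [E] or [G] only moves coordinates, so the induction step becomes five
   scalar identities. *)
have EL p b g r s : E * comb5 E G p b g r s = comb5 E G 0 p 0 g 0.
  rewrite /comb5 !mulrDr -!scalerAr !mulrA EE EGE mul0r mulr1 !scaler0.
  by rewrite !scale0r !(addr0, add0r).
have GL p b g r s : G * comb5 E G p b g r s = comb5 E G 0 0 p 0 b.
  rewrite /comb5 !mulrDr -!scalerAr !mulrA GG GEG mul0r mulr1 !scaler0.
  by rewrite !scale0r !(addr0, add0r) addrC.
elim: w => [|x w IH] /=.
  by rewrite !big_nil /comb5 !(addr0, subr0, scale0r) scale1r.
rewrite !big_cons IH {1}/comb5 !mulrDl -!scalerAl mul1r -!mulrA !(EL, GL).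
rewrite !comb5Z !comb5D.
by congr comb5; ring.
Qed.
End Scalars.

(** * Polynomials over a noncommutative algebra, evaluated at scalars *)

Section Polynomials.
Variables (F : fieldType) (A : algType F).

Lemma commr_scalar (c : F) (a : A) : GRing.comm a c%:A.
Proof. by rewrite /GRing.comm -scalerAl -scalerAr mul1r mulr1. Qed.

(** Scalars are central in [A], so after splitting off the root [c] evaluation at another scalar [d]
    remains multiplicative, and the factor [d - c], a nonzero scalar, can be cancelled. *)
Lemma poly_alg_roots (rs : seq F) (p : {poly A}) : uniq rs ->
  (forall c, c \in rs -> p.[c%:A] = 0) -> (size p <= size rs)%N -> p = 0.
Proof.
elim: rs p => [|c rs IH] p /=.
  by move=> _ _; rewrite leqn0 size_poly_eq0 => /eqP.
case/andP=> rsc urs rp sp.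
have /factor_theorem[q pE] : root p c%:A by apply/eqP/rp/mem_head.
have [q0|q0] := eqVneq q 0; first by rewrite pE q0 mul0r.
rewrite pE (IH q) ?mul0r // => [d rsd|].
  have := rp d; rewrite inE rsd orbT pE hornerM_comm; last first.
    rewrite /comm_poly hornerXsubC; exact/commr_sym/commr_scalar.
  move/(_ isT); rewrite hornerXsubC -scalerBl -scalerAr mulr1 => /eqP.
  rewrite scaler_eq0 subr_eq0 => /orP[/eqP dc|/eqP//].
  by rewrite dc (negPf rsc) in rsd.
by move: sp; rewrite pE size_Mmonic ?monicXsubC // size_XsubC addn2 /= ltnS.
Qed.

Hypothesis charF0 : [pchar F] =i pred0.

Lemma natr_inj : injective (fun n => n%:R : F).
Proof.
move=> i j; wlog ij : i j / (i <= j)%N.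
  by move=> h; case: (leqP i j) => [|/ltnW] /h // h' /esym/h'.
move=> /esym/eqP; rewrite -subr_eq0 -natrB // ((pcharf0P F).1 charF0) subn_eq0.
by move=> ji; apply/eqP; rewrite eqn_leq ij ji.
Qed.

Lemma poly_alg_eq0 (p : {poly A}) : (forall c : F, p.[c%:A] = 0) -> p = 0.
Proof.
(* In characteristic zero the integers 0, 1, ... below [size p] are enough distinct roots. *)
move=> rp; apply: (@poly_alg_roots [seq i%:R | i <- iota 0 (size p)]) => //.
  by rewrite (map_inj_uniq natr_inj) iota_uniq.
by rewrite size_map size_iota.
Qed.
End Polynomials.

(** * First and second order terms as polynomial coefficients *)

Section PolynomialWords.
Variables (F : fieldType) (A : algType F) (u v : X -> A).
(** The indeterminate is the perturbation parameter, so that [word1] becomes a coefficient of a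
    polynomial over [A]. *)
Let U x : {poly A} := (u x)%:P + (v x)%:P * 'X.

Lemma horner_scalarM (p q : {poly A}) (c : F) :
  (p * q).[c%:A] = p.[c%:A] * q.[c%:A].
Proof. by rewrite hornerM_comm //; apply/commr_sym/commr_scalar. Qed.

Lemma horner_affine c x : (U x).[c%:A] = u x + c *: v x.
Proof.
by rewrite hornerD horner_scalarM hornerX !hornerC -scalerAr mulr1.
Qed.

Lemma coef_affineM0 x (p : {poly A}) : (U x * p)`_0 = u x * p`_0.
Proof. by rewrite coef0M coefD coefMX !coefC /= addr0. Qed.

Lemma coef_affineM1 x (p : {poly A}) : (U x * p)`_1 = u x * p`_1 + v x * p`_0.
Proof.
rewrite coefM big_ord_recl big_ord1 /= !coefD !coefMX !coefC /=.
by rewrite addr0 add0r.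
Qed.

Lemma horner_word (c : F) w :
  (\prod_(x <- w) U x).[c%:A] = \prod_(x <- w) (u x + c *: v x).
Proof.
elim: w => [|x w IH]; first by rewrite !big_nil hornerC.
by rewrite !big_cons horner_scalarM IH horner_affine.
Qed.

Lemma coef_word0 w : (\prod_(x <- w) U x)`_0 = \prod_(x <- w) u x.
Proof.
elim: w => [|x w IH]; first by rewrite !big_nil coefC.
by rewrite !big_cons coef_affineM0 IH.
Qed.

Lemma coef_word1 w : (\prod_(x <- w) U x)`_1 = word1 u v w.
Proof.
elim: w => [|x w IH] /=; first by rewrite big_nil coefC.
by rewrite big_cons coef_affineM1 IH coef_word0 addrC.
Qed.

Variable v2 : X -> A.
Let V2 x : {poly A} := (v2 x)%:P.

Lemma horner_word1 (c : F) w :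
  (word1 U V2 w).[c%:A] = word1 (fun x => u x + c *: v x) v2 w.
Proof.
elim: w => [|x w IH] /=; first by rewrite horner0.
by rewrite hornerD !horner_scalarM IH horner_affine hornerC horner_word.
Qed.

Lemma coef_word1_0 w : (word1 U V2 w)`_0 = word1 u v2 w.
Proof.
elim: w => [|x w IH] /=; first by rewrite coef0.
by rewrite coefD coefCM coef_word0 coef_affineM0 IH.
Qed.

(** Perturbing [word1] once more inserts [v] either to the left or to the right of [v2], whence the
    two terms. *)
Lemma coef_word1_1 w : (word1 U V2 w)`_1 = word2 u v v2 w + word2 u v2 v w.
Proof.
elim: w => [|x w IH] /=; first by rewrite coef0 addr0.
rewrite coefD coefCM coef_word1 coef_affineM1 coef_word1_0 IH mulrDr.
by rewrite [LHS](AC (1*(2*1)) ((4*2)*(1*3))).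
Qed.
End PolynomialWords.
End WordExpansion.

(** * Evaluation of free polynomials as sums over words *)

Section Substitution.
Local Open Scope ring_scope.
Variable F : fieldType.

Section LeftAlgebra.
Variable A : lalgType F.
Implicit Types (f g : freeAlg F) (phi : Xvar -> A).

(** Linear extension of an arbitrary function on words: [word1] and [word2] are not multiplicative,
    so [subst] does not cover them. *)
Definition word_sum (V : lmodType F) f (w : seq Xvar -> V) : V :=
  \sum_(m <- msupp f) mcoeff m f *: w m.

Definition scalar_word_sum f (w : seq Xvar -> F) : F :=
  \sum_(m <- msupp f) mcoeff m f * w m.

Lemma scalar_word_sumD f (w w' : seq Xvar -> F) :
  scalar_word_sum f (fun m => w m + w' m) =
  scalar_word_sum f w + scalar_word_sum f w'.
Proof. by rewrite -big_split; apply: eq_bigr => m _; rewrite mulrDr. Qed.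

Lemma scalar_word_sumN f (w : seq Xvar -> F) :
  scalar_word_sum f (fun m => - w m) = - scalar_word_sum f w.
Proof. by rewrite -sumrN; apply: eq_bigr => m _; rewrite mulrN. Qed.

Lemma word_sumZ (V : lmodType F) f (w : seq Xvar -> F) (v : V) :
  word_sum f (fun m => w m *: v) = scalar_word_sum f w *: v.
Proof. by rewrite scaler_suml; apply: eq_bigr => m _; rewrite scalerA. Qed.

Lemma word_sumD (V : lmodType F) f (w w' : seq Xvar -> V) :
  word_sum f (fun m => w m + w' m) = word_sum f w + word_sum f w'.
Proof. by rewrite -big_split; apply: eq_bigr => m _; rewrite scalerDr. Qed.

Lemma eq_word_sum (V : lmodType F) f (w w' : seq Xvar -> V) :
  w =1 w' -> word_sum f w = word_sum f w'.
Proof. by move=> ww'; apply: eq_bigr => m _; rewrite ww'. Qed.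

Lemma subst_word_sum phi f :
  subst phi f = word_sum f (fun m => \prod_(x <- m) phi x).
Proof. by apply: eq_bigr => m _; rewrite mulr_algl. Qed.

Lemma subst0 phi : subst phi 0 = 0.
Proof. exact: mmap0. Qed.

Lemma substD phi f g : subst phi (f + g) = subst phi f + subst phi g.
Proof. exact: mmapD. Qed.

Lemma substB phi f g : subst phi (f - g) = subst phi f - subst phi g.
Proof. exact: mmapB. Qed.

Lemma substU phi c m :
  subst phi (mkmalgU m c) = c *: \prod_(x <- (m : seq Xvar)) phi x.
Proof. by rewrite /subst mmapU mulr_algl. Qed.

Lemma substZ phi c f : subst phi (c *: f) = c *: subst phi f.
Proof.
rewrite {1}/subst (mmapEw (msuppZ_le _ _)) scaler_sumr.
by apply: eq_bigr => m _; rewrite mcoeffZ /= !mulr_algl scalerA.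
Qed.

Lemma subst_xvar phi x : subst phi (xvar F x) = phi x.
Proof. by rewrite substU scale1r fmU big_seq1. Qed.

End LeftAlgebra.

Variable A : algType F.
Implicit Types (f g : freeAlg F) (phi : Xvar -> A).

Lemma substM phi f g : subst phi (f * g) = subst phi f * subst phi g.
Proof.
rewrite malgME [LHS](big_morph _ (substD phi) (subst0 phi)).
rewrite mulr_suml; apply: eq_bigr => m _.
rewrite [LHS](big_morph _ (substD phi) (subst0 phi)).
rewrite mulr_sumr; apply: eq_bigr => m' _.
by rewrite substU fmM big_cat /= !mulr_algl -scalerAl -scalerAr scalerA.
Qed.

Lemma subst_lcommutator2 phi x y :
  subst phi (lcommutator F [:: x; y]) = phi x * phi y - phi y * phi x.
Proof. rewrite [lcommutator _ _]/= substB; congr (_ - _);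
  by rewrite (substM phi (xvar F _) (xvar F _)) !subst_xvar. Qed.

(** The terms of [f] are gathered into one polynomial over [A], which vanishes at all scalars and
    hence is zero. This isolates the component of a given order of an identity. *)
Lemma word_sum_poly_eq0 f (charF0 : [pchar F] =i pred0)
    (Q : seq Xvar -> {poly A}) i :
  (forall c : F, word_sum f (fun m => (Q m).[c%:A]) = 0) ->
  word_sum f (fun m => (Q m)`_i) = 0.
Proof.
move=> Q0; pose P := \sum_(m <- msupp f) ((mcoeff m f)%:A)%:P * Q (m : seq _).
have P0 : P = 0.
  apply: (poly_alg_eq0 charF0) => c; rewrite -[RHS](Q0 c).
  rewrite /P (big_morph (fun p : {poly A} => p.[c%:A])
    (fun p q => hornerD p q _) (horner0 _)).
  by apply: eq_bigr => m _; rewrite hornerCM mulr_algl.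
have /(congr1 (fun p : {poly A} => p`_i)) := P0.
rewrite /P coef_sum coef0 => P0i; rewrite -[RHS]P0i.
by apply: eq_bigr => m _; rewrite coefCM mulr_algl.
Qed.
End Substitution.

(** * Parts of a superalgebra with superinvolution, and polarization of identities *)

Section Polarization.
Local Open Scope ring_scope.
Variables (F : fieldType) (A : starAlg F).
Implicit Types (f : freeAlg F) (phi u v : Xvar -> A).

Lemma star0 : star (0 : A) = 0.
Proof.
have := starP (-1) (0 : A) 0; rewrite scaler0 add0r => ->.
by rewrite scaleN1r addNr.
Qed.

Lemma starB (a b : A) : star (a - b) = star a - star b.
Proof. by rewrite addrC -scaleN1r starP scaleN1r addrC. Qed.

Lemma homogB i (a b : A) : homog i a -> homog i b -> homog i (a - b).
Proof. by move=> ha hb; rewrite addrC -scaleN1r; apply: homogP. Qed.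

(** Let [1 = e0 + e1]. Expanding [1 * e0] and [1 * e1] shows that [e1 * e0] and [e1 * e1] are both
    even and odd, hence zero; so [e1 = e1 * 1 = 0]. *)
Lemma homog1 : homog false (1 : A).
Proof.
have [e0 [e1 [h0 h1 e01]]] := homog_sum (1 : A).
suff e1_0 : e1 = 0 by rewrite e01 e1_0 addr0.
have e10 : e1 * e0 = 0.
  apply: homog_cap; last exact: (homogM h1 h0).
  have -> : e1 * e0 = e0 - e0 * e0.
    by rewrite -[X in X - _]mul1r e01 mulrDl addrAC subrr add0r.
  exact: homogB (h0) (homogM h0 h0).
have e11 : e1 * e1 = 0.
  apply: homog_cap; first exact: (homogM h1 h1).
  have -> : e1 * e1 = e1 - e0 * e1.
    by rewrite -[X in X - _]mul1r e01 mulrDl addrAC subrr add0r.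
  exact: homogB (h1) (homogM h0 h1).
by rewrite -[e1]mulr1 e01 mulrDr e10 e11 addr0.
Qed.

(** Evaluate [star (1 * star 1)] in two ways. *)
Lemma star1 : star (1 : A) = 1.
Proof.
have h := starM homog1 (star_homog homog1); move: h.
by rewrite mul1r starK scale1r mul1r.
Qed.

Lemma sym_part_lin i e (c : F) (a b : A) :
  sym_part i e a -> sym_part i e b -> sym_part i e (c *: a + b).
Proof.
move=> [ha sa] [hb sb]; split; first exact: homogP.
by rewrite starP sa sb scalerDr !scalerA mulrC.
Qed.

Lemma sym_part0 i e : sym_part i e (0 : A).
Proof. by split; [exact: homog0|rewrite star0 scaler0]. Qed.

Lemma sym_partZ i e (c : F) (a : A) : sym_part i e a -> sym_part i e (c *: a).
Proof.
move=> ha; rewrite -[c *: a]addr0.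
by apply: sym_part_lin => //; apply: sym_part0.
Qed.

Lemma sym_part1 : sym_part false false (1 : A).
Proof. by split; [exact: homog1|rewrite star1 scale1r]. Qed.

(** An even factor lets [star] reverse products without a sign, and reversing a commutator negates
    it. Thus [[a, b]] may be substituted for variables of the degree of [b] and the opposite
    symmetry. *)
Lemma sym_part_commutator i e (a b : A) : sym_part false false a ->
  sym_part i e b -> sym_part i (~~ e) (a * b - b * a).
Proof.
move=> [ha sa] [hb sb]; split.
  by apply: homogB; [have := homogM ha hb|have := homogM hb ha; rewrite addbF].
rewrite starB (starM ha hb) (starM hb ha) andbF !scale1r sa sb !scale1r.
rewrite -scalerAl -scalerAr -scalerBr -opprB scalerN -scaleNr.
by congr (_ *: _); case: e {sb} => /=; rewrite ?expr0 ?expr1 ?opprK.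
Qed.

Definition admissible phi :=
  forall i e j, sym_part i e (phi ((i, e), j)).

Lemma admissible_scale (k : kind) (al : Xvar -> F) (a : A) :
  sym_part k.1 k.2 a -> (forall x, x.1 <> k -> al x = 0) ->
  admissible (fun x => al x *: a).
Proof.
move=> ka al0 i e j; have [ek|/eqP ek] := eqVneq (i, e) k.
  by apply: sym_partZ; rewrite -ek in ka.
by rewrite al0 // scale0r; apply: sym_part0.
Qed.

Hypothesis charF0 : [pchar F] =i pred0.

(** For every scalar [c] the substitution [u + c v] is admissible, so the coefficient of [c] in the
    value of [f] vanishes. *)
Lemma Idstar_word1 f u v : Idstar A f -> admissible u -> admissible v ->
  word_sum f (word1 u v) = 0.
Proof.
move=> fA hu hv; under eq_word_sum => m do rewrite -coef_word1.
apply: (word_sum_poly_eq0 charF0) => c.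
under eq_word_sum => m do rewrite horner_word.
rewrite -subst_word_sum; apply: fA => i e j; rewrite addrC.
exact: sym_part_lin.
Qed.

(** This is [Idstar_word1] along [v2] at the base point [u + c v1], followed by taking the
    coefficient of [c]. Only the sum over both orders is obtained. *)
Lemma Idstar_word2 f u v1 v2 : Idstar A f ->
  admissible u -> admissible v1 -> admissible v2 ->
  word_sum f (word2 u v1 v2) + word_sum f (word2 u v2 v1) = 0.
Proof.
move=> fA hu hv1 hv2; rewrite -word_sumD.
under eq_word_sum => m do rewrite -coef_word1_1.
apply: (word_sum_poly_eq0 charF0) => c.
under eq_word_sum => m do rewrite horner_word1.
apply: Idstar_word1 => // i e j; rewrite addrC.
exact: sym_part_lin.
Qed.
End Polarization.

(** * A nonzero commutator in [A] forces membership in the variety *)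

Section Criterion.
Local Open Scope ring_scope.
Variables (F : fieldType) (charF0 : [pchar F] =i pred0) (A : starAlg F).

Lemma Idstar_scalar_prod (f : freeAlg F) (al : Xvar -> F) : Idstar A f ->
  (forall x, x.1 <> even_sym -> al x = 0) ->
  scalar_word_sum f (fun m => \prod_(x <- m) al x) = 0.
Proof.
move=> fA al0; have /fA : admissible (fun x => (al x)%:A : A).
  by apply: (@admissible_scale _ _ even_sym) => //; apply: sym_part1.
rewrite subst_word_sum; under eq_word_sum => m do rewrite prod_scalar.
by rewrite word_sumZ => /eqP; rewrite scaler_eq0 oner_eq0 orbF => /eqP.
Qed.

Lemma Idstar_scalar_word1 (f : freeAlg F) (al be : Xvar -> F) (k : kind)
    (b : A) :
  Idstar A f -> b != 0 -> sym_part k.1 k.2 b ->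
  (forall x, x.1 <> even_sym -> al x = 0) ->
  (forall x, x.1 <> k -> be x = 0) ->
  scalar_word_sum f (word1 al be) = 0.
Proof.
move=> fA b0 kb al0 be0.
have ha : admissible (fun x => (al x)%:A : A).
  by apply: (@admissible_scale _ _ even_sym) => //; apply: sym_part1.
have := Idstar_word1 charF0 fA ha (admissible_scale kb be0).
under eq_word_sum => m do rewrite word1_scalar.
by rewrite word_sumZ => /eqP; rewrite scaler_eq0 (negPf b0) orbF => /eqP.
Qed.

(** Let S and S' be the two sums. Polarizing along an even symmetric [c] and along [b] gives
    [S cb + S' bc = 0]. Taking [c = 1] yields [S' = -S], and then [c = a] yields [S [a, b] = 0]. *)
Lemma Idstar_scalar_word2 (f : freeAlg F) (al be ga : Xvar -> F) (k : kind)
    (a b : A) :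
  Idstar A f -> sym_part false false a -> sym_part k.1 k.2 b ->
  a * b - b * a != 0 ->
  (forall x, x.1 <> even_sym -> al x = 0) ->
  (forall x, x.1 <> even_sym -> be x = 0) ->
  (forall x, x.1 <> k -> ga x = 0) ->
  scalar_word_sum f (word2 al be ga) = 0 /\
  scalar_word_sum f (word2 al ga be) = 0.
Proof.
move=> fA ha hb ab0 al0 be0 ga0.
have adm (c : A) (eta : Xvar -> F) : sym_part false false c ->
    (forall x, x.1 <> even_sym -> eta x = 0) ->
    admissible (fun x => eta x *: c).
  by move=> hc; apply: (@admissible_scale _ _ even_sym).
have w2 (c : A) : sym_part false false c ->
    scalar_word_sum f (word2 al be ga) *: (c * b) +
    scalar_word_sum f (word2 al ga be) *: (b * c) = 0.
  move=> hc; rewrite -!word_sumZ.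
  under eq_word_sum => m do rewrite -word2_scalar.
  under [X in _ + X]eq_word_sum => m do rewrite -word2_scalar.
  apply: (Idstar_word2 charF0 fA); first exact: adm (sym_part1 A) al0.
    exact: adm hc be0.
  exact: admissible_scale hb ga0.
have b0 : b != 0 by apply: contraNneq ab0 => ->; rewrite mulr0 mul0r subrr.
have /eqP := w2 _ (sym_part1 A); rewrite mulr1 mul1r -scalerDl scaler_eq0.
rewrite (negPf b0) orbF addr_eq0 => /eqP s21.
have /eqP := w2 _ ha; rewrite s21 scaleNr addrC -scalerBr scaler_eq0.
rewrite -opprB oppr_eq0 (negPf ab0) orbF => /eqP s0.
by rewrite s0 oppr0.
Qed.

(* A word takes in B a value whose coordinates are, besides the product of its
   scalar parts, the sums word1 and word2 of products of scalars; each of these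
   sums is detected by a substitution in A, at 1, b, [a, b], or at a and b. *)
Lemma in_var_of_commutator (B : starAlg F) (k : kind) (a b : A) (E G : B) :
  sym_part false false a -> sym_part k.1 k.2 b -> a * b - b * a != 0 ->
  E * E = 0 -> G * G = 0 -> E * G * E = 0 -> G * E * G = 0 ->
  (forall i e (y : B), sym_part i e y -> exists al be ga et ze,
    [/\ y = comb5 E G al be ga (et + ze) (et - ze),
        (i, e) <> even_sym -> al = 0 /\ be = 0,
        (i, e) <> k -> ga = 0 /\ et = 0 &
        (i, e) <> (k.1, ~~ k.2) -> ze = 0]) ->
  in_var A B.
Proof.
move=> ha hb ab0 EE GG EGE GEG Bspan f fA phi hphi.
have /choice[c hc] : forall x : Xvar, exists c : F * F * F * F * F,
    let: (al, be, ga, et, ze) := c in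
    [/\ phi x = comb5 E G al be ga (et + ze) (et - ze),
        x.1 <> even_sym -> al = 0 /\ be = 0, x.1 <> k -> ga = 0 /\ et = 0 &
        x.1 <> (k.1, ~~ k.2) -> ze = 0].
  move=> [[i e] j]; have [al [be [ga [et [ze h]]]]] := Bspan _ _ _ (hphi i e j).
  by exists (al, be, ga, et, ze).
pose al x := (c x).1.1.1.1; pose be x := (c x).1.1.1.2.
pose ga x := (c x).1.1.2; pose et x := (c x).1.2; pose ze x := (c x).2.
have phiE x :
    phi x = comb5 E G (al x) (be x) (ga x) (et x + ze x) (et x - ze x).
  by rewrite /al /be /ga /et /ze; case: (c x) (hc x) => [[[[? ?] ?] ?] ?] [].
have al0 x : x.1 <> even_sym -> al x = 0.
  by rewrite /al; case: (c x) (hc x) => [[[[? ?] ?] ?] ?] [_ h _ _] /h[].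
have be0 x : x.1 <> even_sym -> be x = 0.
  by rewrite /be; case: (c x) (hc x) => [[[[? ?] ?] ?] ?] [_ h _ _] /h[].
have ga0 x : x.1 <> k -> ga x = 0.
  by rewrite /ga; case: (c x) (hc x) => [[[[? ?] ?] ?] ?] [_ _ h _] /h[].
have et0 x : x.1 <> k -> et x = 0.
  by rewrite /et; case: (c x) (hc x) => [[[[? ?] ?] ?] ?] [_ _ h _] /h[].
have ze0 x : x.1 <> (k.1, ~~ k.2) -> ze x = 0.
  by rewrite /ze; case: (c x) (hc x) => [[[[? ?] ?] ?] ?] [_ _ _ h] /h.
have b0 : b != 0 by apply: contraNneq ab0 => ->; rewrite mulr0 mul0r subrr.
have [S2 S2'] := Idstar_scalar_word2 fA ha hb ab0 al0 be0 ga0.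
have S0 := Idstar_scalar_prod fA al0.
(* The kind on which a family is supported dictates the test element: 1 for [be], [b] for [ga] and
   [et], and [[a, b]] for [ze]. *)
have Sb := Idstar_scalar_word1 fA (oner_neq0 A)
  (sym_part1 A : sym_part even_sym.1 even_sym.2 _) al0 be0.
have Sg := Idstar_scalar_word1 fA b0 hb al0 ga0.
have Se := Idstar_scalar_word1 fA b0 hb al0 et0.
have Sz := Idstar_scalar_word1 fA ab0
  (sym_part_commutator ha hb : sym_part (k.1, ~~ k.2).1 (k.1, ~~ k.2).2 _)
  al0 ze0.
rewrite subst_word_sum.
under eq_word_sum => m.
  under eq_bigr => x _ do rewrite phiE.
  rewrite prod_word_expansion // /comb5.
  over.
rewrite /= !(word_sumD, word_sumZ, scalar_word_sumD, scalar_word_sumN).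
by rewrite S0 Sb Sg Se Sz S2 S2' oppr0 !addr0 !scale0r !addr0.
Qed.
End Criterion.

(** * Coordinates in the two matrix algebras *)

Section Models.
Local Open Scope ring_scope.
Variables (F : fieldType) (charF0 : [pchar F] =i pred0).

(** The coefficients of e_12 and e_56 are kept independent: reflection then merely swaps [g] with
    [g'] and [r] with [s], and both algebras are covered. *)
Definition gens_comb (p b g g' r s : F) : 'M[F]_6 :=
  p%:A + b *: matE F + (g *: eu F 1 2 + g' *: eu F 5 6) + r *: eu F 1 3 +
  s *: eu F 4 6.

Lemma gens_combP (c : F) (x : 'M[F]_6) :
  x \in <<[:: 1; matE F; eu F 1 2 + c *: eu F 5 6; eu F 1 3; eu F 4 6]%R>>%VS ->
  exists p b g r s, x = gens_comb p b g (g * c) r s.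
Proof.
rewrite !span_cons span_nil addv0.
case/memv_addP => _ /vlineP[p ->] [_ /memv_addP[_ /vlineP[b ->]
  [_ /memv_addP[_ /vlineP[g ->] [_ /memv_addP[_ /vlineP[r ->]
  [_ /vlineP[s ->] ->]] ->]] ->]] ->].
by exists p, b, g, r, s; rewrite /gens_comb -scalerA -scalerDr !addrA.
Qed.

Lemma reflection_gens_comb p b g g' r s :
  reflection (gens_comb p b g g' r s) = gens_comb p b g' g s r.
Proof.
have rZ a x : reflection (a *: x) = a *: reflection x :> 'M[F]_6.
  by rewrite -[a *: x]addr0 reflectionP reflection0 addr0.
have rD x y : reflection (x + y) = reflection x + reflection y :> 'M[F]_6.
  by rewrite -[x in LHS]scale1r reflectionP scale1r.
rewrite /gens_comb /matE !rD !rZ !rD reflection1 !reflection_eu //=.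
rewrite (addrC (eu F (7 - 3) _)) (addrC (g *: _)) -!addrA.
by do 3 congr (_ + _); rewrite addrA addrAC -addrA.
Qed.

Lemma gens_combZ a p b g g' r s :
  a *: gens_comb p b g g' r s =
  gens_comb (a * p) (a * b) (a * g) (a * g') (a * r) (a * s).
Proof. by rewrite /gens_comb !scalerDr !scalerA. Qed.

Definition entry (x : 'M[F]_6) (i j : nat) : F := x (inord i.-1) (inord j.-1).

Lemma entry_eu i j k l : (0 < i <= 6)%N -> (0 < j <= 6)%N ->
  (0 < k <= 6)%N -> (0 < l <= 6)%N ->
  entry (eu F i j) k l = ((k == i) && (l == j))%:R.
Proof.
move=> hi hj hk hl; rewrite /entry mxE -!val_eqE /= !inordK; try lia.
by congr (nat_of_bool _)%:R; lia.
Qed.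

Lemma entry_1 k l : (0 < k <= 6)%N -> (0 < l <= 6)%N ->
  entry 1%:M k l = (k == l)%:R.
Proof.
move=> hk hl; rewrite /entry mxE -!val_eqE /= !inordK; try lia.
by congr (nat_of_bool _)%:R; lia.
Qed.

(** Each of these six positions is met by only one of the six matrices being combined. *)
Lemma entry_gens_comb p b g g' r s (x := gens_comb p b g g' r s) :
  [/\ entry x 1 1 = p, entry x 2 3 = b & entry x 1 2 = g] /\
  [/\ entry x 5 6 = g', entry x 1 3 = r & entry x 4 6 = s].
Proof.
have eD (y z : 'M[F]_6) k l : entry (y + z) k l = entry y k l + entry z k l.
  by rewrite /entry mxE.
have eZ a (y : 'M[F]_6) k l : entry (a *: y) k l = a * entry y k l.
  by rewrite /entry mxE.
rewrite /x /gens_comb /matE !(eD, eZ) !entry_1 // !entry_eu //=.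
by rewrite !(mulr0, mulr1, addr0, add0r).
Qed.

Lemma gens_comb_inj p b g g' r s p1 b1 g1 g1' r1 s1 :
  gens_comb p b g g' r s = gens_comb p1 b1 g1 g1' r1 s1 ->
  [/\ p = p1, b = b1 & g = g1] /\ [/\ g' = g1', r = r1 & s = s1].
Proof.
move=> e; have [[h1 h2 h3] [h4 h5 h6]] := entry_gens_comb p b g g' r s.
have [[k1 k2 k3] [k4 k5 k6]] := entry_gens_comb p1 b1 g1 g1' r1 s1.
rewrite e in h1 h2 h3 h4 h5 h6.
by split; split;
  [rewrite -h1|rewrite -h2|rewrite -h3|rewrite -h4|rewrite -h5|rewrite -h6].
Qed.

Lemma sign_eq0 (e : bool) (x : F) : e -> x = (-1) ^+ e * x -> x = 0.
Proof.
case: e => // _ /eqP; rewrite expr1 mulN1r -addr_eq0 -mulr2n -mulr_natl.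
by rewrite mulf_eq0 ((pcharf0P F).1 charF0) => /eqP.
Qed.

Section Coordinates.
Variables (B : {aspace 'M[F]_6}) (d i0 : bool).
(** [d = false] gives [U3] and [d = true] gives [N3]. As [G = e_12 + c e_56] reflects to [c G], [d]
    is also the symmetry of [G]; [i0] stands for its degree. *)
Let c : F := (-1) ^+ d.
Hypothesis BE : B =
  <<[:: 1; matE F; eu F 1 2 + c *: eu F 5 6; eu F 1 3; eu F 4 6]%R>>%VS
  :> {vspace _}.

Definition genE : subvs_of B := vsproj B (matE F).
Definition genG : subvs_of B := vsproj B (eu F 1 2 + c *: eu F 5 6).

Lemma vsval_genE : vsval genE = matE F.
Proof. by rewrite vsprojK // BE memv_span // !inE eqxx orbT. Qed.

Lemma vsval_genG : vsval genG = eu F 1 2 + c *: eu F 5 6.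
Proof. by rewrite vsprojK // BE memv_span // !inE eqxx !orbT. Qed.

Lemma algid_gens : algid B = 1.
Proof. by apply/eqP; rewrite algid_eq1 /= BE gens1. Qed.

Lemma mul_genEG : vsval genE * vsval genG = c *: eu F 4 6.
Proof.
rewrite vsval_genE vsval_genG /matE !mulrDl !mulrDr -!scalerAr !mul_eu //=.
by rewrite !(scaler0, addr0, add0r).
Qed.

Lemma mul_genGE : vsval genG * vsval genE = eu F 1 3.
Proof.
rewrite vsval_genE vsval_genG /matE !mulrDl !mulrDr -!scalerAl !mul_eu //=.
by rewrite !(scaler0, addr0, add0r).
Qed.

Lemma gen_relations : [/\ genE * genE = 0, genG * genG = 0,
  genE * genG * genE = 0 & genG * genE * genG = 0].
Proof.
split; apply: val_inj; rewrite /=.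
- by rewrite vsval_genE /matE !mulrDl !mulrDr !mul_eu //= !addr0.
- rewrite vsval_genG !mulrDl !mulrDr -!scalerAl -!scalerAr !mul_eu //=.
  by rewrite !scaler0 !addr0.
- rewrite mul_genEG vsval_genE -scalerAl /matE mulrDr !mul_eu //=.
  by rewrite addr0 scaler0.
- rewrite mul_genGE vsval_genG mulrDr -scalerAr !mul_eu //=.
  by rewrite scaler0 addr0.
Qed.

(** The first two hypotheses are what the grading contributes: no 1 or [E] in odd degree, no [G] or
    product of [E] and [G] outside degree [i0]. The reflection condition removes the coordinates of
    the wrong symmetry, since 2 is invertible. *)
Lemma subvs_coordinates (i e : bool) (y : subvs_of B) :
  (i -> entry (vsval y) 1 1 = 0 /\ entry (vsval y) 2 3 = 0) ->
  (i <> i0 -> entry (vsval y) 1 2 = 0 /\ entry (vsval y) 1 3 = 0) ->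
  reflection (vsval y) = (-1) ^+ e *: vsval y ->
  exists al be ga et ze : F,
    [/\ y = comb5 genE genG al be ga (et + ze) (et - ze),
        (i, e) <> even_sym -> al = 0 /\ be = 0,
        (i, e) <> (i0, d) -> ga = 0 /\ et = 0 &
        (i, e) <> (i0, ~~ d) -> ze = 0].
Proof.
have [p [b [g [r [s yE]]]]] :
    exists p b g r s, vsval y = gens_comb p b g (g * c) r s.
  by apply: gens_combP; rewrite -BE subvsP.
rewrite yE; have [[-> -> ->] [_ -> _]] := entry_gens_comb p b g (g * c) r s.
move=> pb0 gr0; rewrite reflection_gens_comb gens_combZ.
case/gens_comb_inj => -[pp bb gg] [_ sr _].
(* Since [GE = e_13] and [EG = c e_46], the coordinates on [GE] and [EG] are [r] and [c s].
   Reflection gives [s = (-1)^e r], so [c s] is [r] if [e = d] and [-r] otherwise: only [EG + GE],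
   respectively only [EG - GE], occurs. *)
exists p, b, g, (if e == d then r else 0), (if e == d then 0 else - r); split.
- apply: val_inj; rewrite /comb5 /= algid_gens mul_genEG mul_genGE.
  rewrite vsval_genE vsval_genG yE /gens_comb.
  rewrite -(scalerA g c) -scalerDr addrAC scalerA; congr (_ + _ *: _ + _ *: _).
    rewrite sr /c; case: (e); case: (d) => /=;
      by rewrite ?expr0 ?expr1 ?addr0 ?add0r ?mulrN1 ?mulN1r ?mul1r ?mulr1
        ?opprK.
  by case: ifP; rewrite ?subr0 ?sub0r ?opprK.
- case: i e pb0 gr0 pp bb gg sr => [] [] //= pb0 _ pp bb _ _ _.
  + by have [-> ->] := pb0 isT.
  + by have [-> ->] := pb0 isT.
  + by split; apply: (@sign_eq0 true).
- have [ii|/eqP ii _] := eqVneq i i0; last first.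
    by have [-> ->] := gr0 ii; case: ifP.
  have [->|ed _] := eqVneq e d; first by rewrite ii.
  (* For [e <> d] the signs [c] and [(-1)^e] are opposite, so [gg] says [g = -g]. *)
  split=> //; apply: (@sign_eq0 true) => //; move: gg; rewrite /c mulrC.
  by case: (e) (d) ed => [] [] // _; rewrite expr0 mul1r // => h;
    rewrite [RHS]h.
- have [ii|/eqP ii _] := eqVneq i i0; last first.
    by have [_ ->] := gr0 ii; case: ifP; rewrite ?oppr0.
  by case: eqVneq => // ed; rewrite ii; case: (e) (d) ed => [] [].
Qed.
End Coordinates.
End Models.

(** * The three model algebras and their nonzero commutators *)

Definition identity_commutator (F : fieldType) (A : starAlg F) (k : kind) :
    Prop :=
  forall a b : A, sym_part false false a -> sym_part k.1 k.2 b ->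
  (a * b - b * a)%R = 0%R.

Section Instances.
Local Open Scope ring_scope.
Variables (F : fieldType) (charF0 : [pchar F] =i pred0) (A : starAlg F).

Lemma N3_gens : N3 F = <<[:: 1; matE F; eu F 1 2 + (-1) ^+ true *: eu F 5 6;
  eu F 1 3; eu F 4 6]%R>>%VS :> {vspace _}.
Proof. by rewrite /= N3_spaceE. Qed.

Lemma U3_gens : U3 F = <<[:: 1; matE F; eu F 1 2 + (-1) ^+ false *: eu F 5 6;
  eu F 1 3; eu F 4 6]%R>>%VS :> {vspace _}.
Proof. by rewrite /= U3_spaceE. Qed.

(** By [g6] the positions (1,1) and (2,3) are even, (1,2) and (1,3) odd; this supplies
    [subvs_coordinates] with [i0] true. *)
Lemma elementary_true_entries (x : 'M[F]_6) i : elementary_homog i x ->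
  (i -> entry x 1 1 = 0 /\ entry x 2 3 = 0) /\
  (i <> true -> entry x 1 2 = 0 /\ entry x 1 3 = 0).
Proof.
move=> hx; have e0 k l : (0 < k <= 6)%N -> (0 < l <= 6)%N ->
    nth false g6 k.-1 (+) nth false g6 l.-1 <> i -> entry x k l = 0.
  move=> hk hl hi; apply/eqP/negPn/negP => /hx.
  by rewrite !inordK //; lia.
by split; case: i hx e0 => // hx e0 _; rewrite !e0.
Qed.

Lemma not_commutator_ex (A0 : starAlg F) k : ~ identity_commutator A0 k ->
  exists a b : A0, [/\ sym_part false false a, sym_part k.1 k.2 b &
    a * b - b * a != 0].
Proof.
move=> h; apply: contrapT => h'; apply: h => a b ha hb.
by apply: contrapT => /eqP ab0; apply: h'; exists a, b.
Qed.

Lemma in_var_U3_gri :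
  ~ identity_commutator A odd_sym -> in_var A (U3_star_gri F).
Proof.
case/not_commutator_ex => a [b [ha hb ab0]].
have [EE GG EGE GEG] := gen_relations U3_gens.
apply: (in_var_of_commutator charF0 (B := U3_star_gri F) (E := genE (U3 F))
  (G := genG (U3 F) false) ha hb ab0) => // i e y [hy sy].
have [h1 h2] := elementary_true_entries hy.
apply: (subvs_coordinates charF0 U3_gens h1 h2).
by rewrite -(vsval_star (@U3_reflection F)) [sub_star y]sy.
Qed.

Lemma in_var_N3_gri :
  ~ identity_commutator A odd_skew -> in_var A (N3_star_gri F).
Proof.
case/not_commutator_ex => a [b [ha hb ab0]].
have [EE GG EGE GEG] := gen_relations N3_gens.
apply: (in_var_of_commutator charF0 (B := N3_star_gri F) (E := genE (N3 F))
  (G := genG (N3 F) true) ha hb ab0) => // i e y [hy sy].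
have [h1 h2] := elementary_true_entries hy.
apply: (subvs_coordinates charF0 N3_gens h1 h2).
by rewrite -(vsval_star (@N3_reflection F)) [sub_star y]sy.
Qed.

Lemma in_var_N3 : ~ identity_commutator A even_skew -> in_var A (N3_star F).
Proof.
case/not_commutator_ex => a [b [ha hb ab0]].
have [EE GG EGE GEG] := gen_relations N3_gens.
apply: (in_var_of_commutator charF0 (B := N3_star F) (E := genE (N3 F))
  (G := genG (N3 F) true) ha hb ab0) => // i e y [hy sy].
(* In the trivial grading an odd element is zero, and [G] is even. *)
have y0 k l : i -> entry (vsval y) k l = 0.
  by move=> hi; have -> : y = 0 by [exact: hy]; rewrite /entry mxE.
apply: (subvs_coordinates charF0 N3_gens) => [hi|hi|].
- by rewrite !y0.
- by rewrite !y0 //; case: i hi {hy sy y0}.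
by rewrite -(vsval_star (@N3_reflection F)) [sub_star y]sy.
Qed.

(** The entry (1,3) is -1, because [GE = e_13] while [EG] is a multiple of e_46. *)
Lemma commutator_gens_neq0 (B : {aspace 'M[F]_6}) (d : bool) (BE : B =
  <<[:: 1; matE F; eu F 1 2 + (-1) ^+ d *: eu F 5 6; eu F 1 3; eu F 4 6]%R>>%VS
    :> {vspace _}) :
  genE B * genG B d - genG B d * genE B <> 0.
Proof.
move/(congr1 (fun y : subvs_of B => entry (vsval y) 1 3)).
rewrite /= (mul_genEG BE) (mul_genGE BE) /entry !mxE -!val_eqE /= !inordK //=.
by rewrite mulr0 add0r => /eqP; rewrite oppr_eq0 oner_eq0.
Qed.

Lemma reflection_gens (d : bool) :
  reflection (matE F) = matE F /\
  reflection (eu F 1 2 + (-1) ^+ d *: eu F 5 6) =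
  (-1) ^+ d *: (eu F 1 2 + (-1) ^+ d *: eu F 5 6).
Proof.
have E0 : matE F = gens_comb 0 1 0 0 0 0.
  by rewrite /gens_comb !scale0r scale1r !addr0 add0r.
have E1 (c : F) : eu F 1 2 + c *: eu F 5 6 = gens_comb 0 0 1 c 0 0.
  by rewrite /gens_comb !scale0r scale1r !addr0 !add0r.
rewrite E0 E1 !reflection_gens_comb gens_combZ !mulr0 mulr1.
by rewrite -signr_addb addbb.
Qed.

Lemma commutator_U3_gri : ~ identity_commutator (U3_star_gri F) odd_sym.
Proof.
move=> h; apply: (commutator_gens_neq0 U3_gens); apply: h; split.
- rewrite /= /elementary_grading (vsval_genE U3_gens).
  by apply: homog_gens0; rewrite !inE eqxx orbT.
- apply: val_inj; rewrite [LHS](vsval_star (@U3_reflection F)) /=.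
  by rewrite (vsval_genE U3_gens) scale1r; have [] := reflection_gens true.
- rewrite /= /elementary_grading (vsval_genG U3_gens) addrC.
  by apply: elementary_homogP; apply: homog_eu.
- apply: val_inj; rewrite [LHS](vsval_star (@U3_reflection F)) /=.
  by rewrite (vsval_genG U3_gens); have [] := reflection_gens false.
Qed.

Lemma commutator_N3_gri : ~ identity_commutator (N3_star_gri F) odd_skew.
Proof.
move=> h; apply: (commutator_gens_neq0 N3_gens); apply: h; split.
- rewrite /= /elementary_grading (vsval_genE N3_gens).
  by apply: homog_gens0; rewrite !inE eqxx orbT.
- apply: val_inj; rewrite [LHS](vsval_star (@N3_reflection F)) /=.
  by rewrite (vsval_genE N3_gens) scale1r; have [] := reflection_gens true.
- rewrite /= /elementary_grading (vsval_genG N3_gens) addrC.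
  by apply: elementary_homogP; apply: homog_eu.
- apply: val_inj; rewrite [LHS](vsval_star (@N3_reflection F)) /=.
  by rewrite (vsval_genG N3_gens); have [] := reflection_gens true.
Qed.

Lemma commutator_N3 : ~ identity_commutator (N3_star F) even_skew.
Proof.
move=> h; apply: (commutator_gens_neq0 N3_gens); apply: h; split => //.
- apply: val_inj; rewrite [LHS](vsval_star (@N3_reflection F)) /=.
  by rewrite (vsval_genE N3_gens) scale1r; have [] := reflection_gens true.
- apply: val_inj; rewrite [LHS](vsval_star (@N3_reflection F)) /=.
  by rewrite (vsval_genG N3_gens); have [] := reflection_gens true.
Qed.
End Instances.

(** * Multiplicities in degree two *)

Section Multiplicities.
Local Open Scope ring_scope.
Variables (F : fieldType).

Lemma perm_le1 n (s : 'S_n) : (n <= 1)%N -> s = 1%g.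
Proof.
case: n s => [|[|//]] s _; apply/permP; first by case.
by move=> i; rewrite !ord1.
Qed.

(** The group is trivial and the symmetrizer is 1, so the ideal is the whole one-dimensional group
    algebra, and the trace is its dimension. *)
Lemma irr_char_le1 n l (s : 'S_n) : (n <= 1)%N -> irr_char F l s = 1.
Proof.
move=> n1; rewrite /irr_char; set U := (X in submod_repr X).
have s1 : forall t : 'S_n, t = 1%g by move=> t; apply: perm_le1.
have c1 : #|[set: 'S_n]| = 1%N.
  rewrite (_ : [set: 'S_n] = [set 1%g]) ?cards1 //.
  by apply/setP=> t; rewrite !inE (s1 t) eqxx.
rewrite (s1 s) repr_mx1 mxtrace1.
set M := cyclic_mx _ _; suff -> : \rank M = 1%N by [].
have r1 : (\rank M <= 1)%N by exact: leq_trans (rank_leq_row M) (eq_leq c1).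
apply/eqP; rewrite eqn_leq r1 lt0n mxrank_eq0 /=.
(* A zero ideal would contain the symmetrizer, whose coefficient at the identity is 1. *)
apply: contraTneq (cyclic_mx_id (regular_repr F [set: 'S_n]%G)
  (gring_row (young_symmetrizer F n l))) => M0.
rewrite -/M M0 submx0.
have row1 : row_stab n l = [set 1%g].
  by apply/setP=> t; rewrite !inE (s1 t) eqxx; apply/forallP=> i; rewrite perm1.
have col1 : col_stab n l = [set 1%g].
  by apply/setP=> t; rewrite !inE (s1 t) eqxx; apply/forallP=> i; rewrite perm1.
rewrite /young_symmetrizer row1 col1 !big_set1 odd_perm1 expr0 scale1r.
rewrite mulg1 repr_mx1 /gring_row rowE mulmx1.
apply/eqP=> /matrixP/(_ 0 (gring_index [set: 'S_n]%G 1))/eqP.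
by rewrite !mxE !eqxx oner_eq0.
Qed.

Lemma block_perm_le1 o n (s : 'S_n) j : (n <= 1)%N -> block_perm o s j = j.
Proof.
move=> n1; rewrite (perm_le1 s n1) /block_perm; case: ifP => // oj.
by case: insubP => // i _ iE; rewrite perm1 iE subnKC.
Qed.

Lemma xvar_prod (m : seq Xvar) : \prod_(x <- m) xvar F x = mkmalgU (FMonom m) 1.
Proof.
elim: m => [|x m IH]; first by rewrite big_nil -fmoneE.
rewrite big_cons IH /xvar.
have -> : FMonom (x :: m) = mmul (fmu x) (FMonom m).
  by apply: val_inj; rewrite /= fmM fmU.
by rewrite malgM_def fgmulUU mulr1.
Qed.

(** Renaming by permutations of at most one letter is this substitution, hence acts trivially. *)
Lemma subst_xvar_id (f : freeAlg F) : subst (xvar F) f = f.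
Proof.
rewrite subst_word_sum [RHS]monalgE; apply: eq_bigr => m _.
by rewrite xvar_prod fmK -mul_malgC malgM_def fgmulUU mulr1 mul1m.
Qed.

Lemma Idstar_subspace (A : starAlg F) : subspace (Idstar A).
Proof.
split=> [phi _|c f g fA gA phi hphi]; first exact: subst0.
by rewrite substD substZ fA // gA // scaler0 addr0.
Qed.

(** As [k] is not [even_sym], a substitution depending only on the kind can send the two variables
    to any prescribed [a] and [b]. *)
Lemma Idstar_commutator (A : starAlg F) (k : kind) : k <> even_sym ->
  Idstar A (lcommutator F [:: (even_sym, 0%N); (k, 1%N)]) <->
  identity_commutator A k.
Proof.
move=> k0; split=> h.
  move=> a b ha hb; pose phi (x : Xvar) : A :=
    if x.1 == even_sym then a else if x.1 == k then b else 0.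
  have /h : admissible phi.
    move=> i e j; rewrite /phi /=; case: eqP => [[-> ->] //|_].
    by case: eqP => [kE|_]; [rewrite -kE in hb|exact: sym_part0].
  rewrite subst_lcommutator2 /phi /= eqxx.
  by case: eqP => // _; rewrite eqxx.
move=> phi hphi; rewrite subst_lcommutator2; apply: h; first exact: hphi.
by case: (k) => i e; apply: hphi.
Qed.

Section CommutatorSpace.
Variables (A : starAlg F) (k : kind) (k0 : k <> even_sym) (n2 n3 n4 : nat).
Hypothesis varsE : Gamma_vars 1 n2 n3 n4 = [:: (even_sym, 0%N); (k, 1%N)].
Let C := lcommutator F [:: (even_sym, 0%N); (k, 1%N)].

Lemma proper_product_commutator : proper_product 1 n2 n3 n4 C.
Proof.
exists [::], [::], [::], [:: [:: (even_sym, 0%N); (k, 1%N)]].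
split=> //; split; first by rewrite varsE.
by rewrite !big_nil big_seq1 !mul1r.
Qed.

(** The even symmetric variable can occur only inside a commutator. That commutator has length at
    least 2 and so uses up both variables, in one of two orders. *)
Lemma proper_productP u : proper_product 1 n2 n3 n4 u -> u = C \/ u = - C.
Proof.
case=> ys [zs [ws [cs [hy hz hw hc [pe ->]]]]]; rewrite varsE in pe.
have x_in : (even_sym, 0%N) \in flatten cs.
  have := perm_mem pe (even_sym, 0%N); rewrite !mem_cat inE eqxx /=.
  have nin (s : seq Xvar) k' : k' != even_sym ->
      all (fun x => x.1 == k') s -> (even_sym, 0%N) \in s = false.
    by move=> k'0 /allP h; apply/negP => /h /=; rewrite eq_sym (negPf k'0).
  by rewrite (nin ys even_skew) // (nin zs odd_sym) // (nin ws odd_skew).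
have /= sz := perm_size pe; rewrite !size_cat in sz.
have [c [cs1 [cs2 csE]]] : exists c cs1 cs2, cs = cs1 ++ c :: cs2.
  have /flattenP[c ccs _] := x_in.
  by have [cs1 cs2] := path.splitPr ccs; exists c, cs1, cs2.
move: hc sz pe; rewrite {x_in}csE.
rewrite flatten_cat /= !size_cat all_cat /= => /and3P[hc1 hc hc2] sz.
(* Commutators are nonempty words, so an empty concatenation comes from an empty list. *)
have cs0 (s : seq (seq Xvar)) : all (fun c => 1 < size c)%N s ->
    flatten s = [::] -> s = [::].
  by case: s => [|[] ] //.
have arith (n1 n2' n3' n4' n5 n6 : nat) : (1 < n5)%N ->
    (n1 + (n2' + (n3' + (n4' + (n5 + n6)))) = 2 ->
    [/\ n1 = 0, n2' = 0 & n3' = 0] /\ [/\ n4' = 0, n6 = 0 & n5 = 2])%N.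
  by move=> ? ?; split; split; lia.
have [[/size0nil-> /size0nil-> /size0nil->]] := arith _ _ _ _ _ _ hc sz.
case=> /size0nil e1 /size0nil e2 sc.
rewrite e1 e2 (cs0 cs1 hc1 e1) (cs0 cs2 hc2 e2).
rewrite !cat0s cats0 !big_nil big_seq1 !mul1r.
case: c {hc sz} sc => [|x [|y [|? ?]]] // _ pe.
have [xe|xk] : x = (even_sym, 0%N) \/ x = (k, 1%N).
  by move: (perm_mem pe x); rewrite !inE eqxx => /esym/orP[] /eqP; [left|right].
- move: pe; rewrite xe perm_cons => /perm_small_eq ye; left.
  by have [->] := ye isT.
- move: pe; rewrite xk (perm_sym _ [:: (even_sym, 0%N); _]).
  rewrite (perm_catC [:: (even_sym, 0%N)] [:: (k, 1%N)]) /= perm_cons perm_sym.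
  by move=> /perm_small_eq ye; right; have [->] := ye isT; rewrite /C /= opprB.
Qed.

Lemma GammaP u : Gamma 1 n2 n3 n4 u -> exists c : F, u = c *: C.
Proof.
case=> d [c [v [hv ->]]].
have /choice[e he] i : exists e, v i = e *: C.
  case: (proper_productP (hv i)) => ->; first by exists 1; rewrite scale1r.
  by exists (-1); rewrite scaleN1r.
exists (\sum_i c i * e i); rewrite scaler_suml; apply: eq_bigr => i _.
by rewrite he scalerA.
Qed.

Lemma Gamma_commutator : Gamma 1 n2 n3 n4 C.
Proof.
exists 1%N, (fun _ => 1), (fun _ => C); split; last by rewrite big_ord1 scale1r.
by move=> _; apply: proper_product_commutator.
Qed.

Hypotheses (n2_le1 : (n2 <= 1)%N) (n3_le1 : (n3 <= 1)%N) (n4_le1 : (n4 <= 1)%N).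

(** The space is the line through [C] with trivial action, so the trace is the dimension of the
    quotient: the basis is empty if [C] is an identity and [C] itself otherwise. *)
Lemma proper_character_commutator (s1 : 'S_1) (s2 : 'S_n2) (s3 : 'S_n3)
    (s4 : 'S_n4) :
  proper_character A s1 s2 s3 s4 = (~~ `[< identity_commutator A k >])%:R.
Proof.
rewrite /proper_character; set f := subst _.
have fE u : f u = u.
  rewrite -[RHS]subst_xvar_id /f; congr (subst _ u).
  apply/funext => -[[[] []] j];
    by rewrite /rename /= block_perm_le1.
have flin : linear f by move=> c u v; rewrite !fE.
have fA u : Idstar A u -> Idstar A (f u) by rewrite fE.
have sA := Idstar_subspace A.
case: asboolP => [/(Idstar_commutator A k0) CA|nCA] /=.
  rewrite (@qtraceE _ _ _ _ sA f 0 (fun _ => 0) 0) ?mxtrace0 //; last by case.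
  split=> [[]//|c _ []//|u /GammaP[c ->]]; exists (fun _ => 0).
  by rewrite big_ord0 subr0; apply: (subspaceZ sA).
rewrite (@qtraceE _ _ _ _ sA f 1 (fun _ => C) 1%:M) ?mxtrace1 //; last first.
  move=> j; rewrite big_ord1 fE mxE !ord1 eqxx mulr1n scale1r subrr.
  by case: sA.
split=> [_|c hc i|u /GammaP[c ->]]; first exact: Gamma_commutator.
  rewrite ord1; move: hc; rewrite big_ord1 => hc.
  apply: contrapT => /eqP c0; apply/nCA/(Idstar_commutator A k0).
  by rewrite -[lcommutator _ _](scalerK c0); apply: (subspaceZ sA).
by exists (fun _ => c); rewrite big_ord1 subrr; case: sA.
Qed.
End CommutatorSpace.

Hypothesis charF0 : [pchar F] =i pred0.

Lemma mult_nat (A : starAlg F) l1 l2 l3 l4 (d : nat) :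
  all (fun l => (sumn l <= 1)%N && (partns (sumn l) == [:: l]))
    [:: l1; l2; l3; l4] ->
  (forall s1 s2 s3 s4,
    @proper_character F A (sumn l1) (sumn l2) (sumn l3) (sumn l4) s1 s2 s3 s4 =
    d%:R) ->
  mult A l1 l2 l3 l4 = d.
Proof.
case/and5P=> /andP[h1 /eqP p1] /andP[h2 /eqP p2] /andP[h3 /eqP p3].
case/andP=> h4 /eqP p4 _ hd.
have chi m s1 s2 s3 s4 :
    \sum_(m1 <- partns (sumn l1)) \sum_(m2 <- partns (sumn l2))
    \sum_(m3 <- partns (sumn l3)) \sum_(m4 <- partns (sumn l4))
      (m m1 m2 m3 m4)%:R *
      (@irr_char F (sumn l1) m1 s1 * @irr_char F (sumn l2) m2 s2 *
       @irr_char F (sumn l3) m3 s3 * @irr_char F (sumn l4) m4 s4) =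
    (m l1 l2 l3 l4)%:R :> F.
  by rewrite p1 p2 p3 p4 !big_seq1 !irr_char_le1 // !mulr1.
(* The constant function [d] is a decomposition, which rules out the default of [xget]; any
   decomposition takes the value [d] here because naturals embed in [F]. *)
rewrite /mult; case: xgetP => [m -> hm|/(_ (fun _ _ _ _ => d))[]]; last first.
  by move=> s1 s2 s3 s4; rewrite hd chi.
by have := hm 1%g 1%g 1%g 1%g; rewrite hd chi => /(natr_inj charF0).
Qed.

Lemma mult_commutator_eq1 (A : starAlg F) (k : kind) l2 l3 l4 :
  k <> even_sym ->
  Gamma_vars 1 (sumn l2) (sumn l3) (sumn l4) = [:: (even_sym, 0%N); (k, 1%N)] ->
  all (fun l => (sumn l <= 1)%N && (partns (sumn l) == [:: l]))
    [:: l2; l3; l4] ->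
  mult A [:: 1%N] l2 l3 l4 = 1%N <-> ~ identity_commutator A k.
Proof.
move=> k0 varsE /[dup] /and4P[/andP[h2 _] /andP[h3 _] /andP[h4 _] _] hl.
rewrite (@mult_nat A _ _ _ _ (~~ `[< identity_commutator A k >])) //.
  by case: asboolP => /=.
by move=> s1 s2 s3 s4; apply: proper_character_commutator.
Qed.
End Multiplicities.

Lemma in_var_commutator (F : fieldType) (A B : starAlg F) (k : kind) :
  k <> even_sym -> in_var A B -> ~ identity_commutator B k ->
  ~ identity_commutator A k.
Proof.
move=> k0 AB nB /(Idstar_commutator A k0)/AB/(Idstar_commutator B k0).
exact: nB.
Qed.

Theorem lemma4p4 (R : realType) (F : fieldType) (charF0 : [pchar F]%R =i pred0)
    (A : starAlg F) (A_FJ : type_FJ A) (A_quad : quadratic_growth R A) :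
  [/\ mult A [:: 1] [::] [:: 1] [::] = 1 <-> in_var A (U3_star_gri F),
      mult A [:: 1] [:: 1] [::] [::] = 1 <-> in_var A (N3_star F)
    & mult A [:: 1] [::] [::] [:: 1] = 1 <-> in_var A (N3_star_gri F)].
Proof.
(* In all three items both sides are equivalent to [[x, z]] not being an identity of [A]; only the
   kind of [z] and the model change. *)
have key k l2 l3 l4 B : k <> even_sym ->
    Gamma_vars 1 (sumn l2) (sumn l3) (sumn l4) = [:: (even_sym, 0); (k, 1)] ->
    all (fun l => (sumn l <= 1) && (partns (sumn l) == [:: l]))
      [:: l2; l3; l4] ->
    ~ identity_commutator B k -> (~ identity_commutator A k -> in_var A B) ->
    mult A [:: 1] l2 l3 l4 = 1 <-> in_var A B.
  move=> k0 varsE hl nB nAB; rewrite (mult_commutator_eq1 charF0 A k0 varsE hl).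
  by split=> // AB; apply: in_var_commutator k0 AB nB.
split.
- apply: (key odd_sym) => //.
  + exact: commutator_U3_gri.
  + exact: in_var_U3_gri.
- apply: (key even_skew) => //.
  + exact: commutator_N3.
  + exact: in_var_N3.
- apply: (key odd_skew) => //.
  + exact: commutator_N3_gri.
  + exact: in_var_N3_gri.
Qed.
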